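(* Consider the spectrum-oligopoly game described in the context when the conflict graph is the linear graph (path) on nodes $1,\dots,M$ ($M\ge2$) with edges $\{i,i+1\}$, $1\le i<M$. There exists a unique symmetric Nash equilibrium strategy profile (unique as a strategy profile, not merely in node-selection probabilities). In it, in every channel state, each primary selects only the independent sets $I_1=\{$odd-numbered nodes$\}$ and $I_2=\{$even-numbered nodes$\}$.
   Context: Model. $l$ primaries; $m$ secondaries at each node, integers $1\le m<l$. Each primary's channel state $j\in\{0,\dots,n\}$ is the same at every node; states independent across primaries, equal to $j$ w.p. $q_j$, $\sum_{j\ge1}q_j<1$; state 0 means unsellable. Constants $c$, $v$. For $j=1..n$, $g_j$ continuous strictly increasing, $g_i(p)<g_j(p)$ for $i>j$, $f_j=g_j^{-1}$, for $i<j$, $x>y>g_i(c)$: $\frac{f_i(y)-c}{f_j(y)-c}<\frac{f_i(x)-c}{f_j(x)-c}$; and $f_1(v)>c$. In state $j\ge1$ a primary (knowing only its own state) chooses, possibly randomly, an independent set of the conflict graph and a penalty at each of its nodes; a strategy specifies, for each state $j\ge1$, a distribution over independent sets and penalty distributions at nodes. At each node the $\min(Y,m)$ lowest-penalty offers among the $Y$ offers with penalty $\le v$ are sold (ties uniformly random); a sale at penalty $x$ in state $j$ earns $f_j(x)-c$, else 0; payoff sums over nodes. Nash equilibrium: no primary in any state can gain by unilateral deviation; symmetric if all primaries use the same strategy.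
   Formalization: Assumes every state j≥1 has q_j>0 (with M=4 and all q_j=0 uniqueness and the claim on I_1, I_2 fail), and takes each g_j to be a bijection of the reals so f_j(x) is defined for every penalty; uniqueness ignores penalties at never-selected nodes. *)

(* Defs.v *)
From HB Require Import structures.
From mathcomp Require Import all_boot all_order all_algebra.
From mathcomp Require Import all_classical all_reals all_analysis.
Set Implicit Arguments. Unset Strict Implicit. Unset Printing Implicit Defensive.
Import Order.TTheory GRing.Theory Num.Theory.
Local Open Scope ring_scope.
Local Open Scope classical_set_scope.

(* ---------- Conflict graph: the path on nodes 0..M-1 (paper's 1..M) ---------- *)

Definition path_adj (M : nat) (i j : 'I_M) : bool :=
  (i.+1 == j :> nat) || (j.+1 == i :> nat).

Definition indep (M : nat) (I : {set 'I_M}) : bool :=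
  [forall i : 'I_M, forall j : 'I_M, ((i \in I) && (j \in I)) ==> ~~ path_adj i j].

(* I_1 = odd-numbered nodes 1,3,5,... = 0-based indices 0,2,4,... *)
Definition I_odd (M : nat) : {set 'I_M} := [set i : 'I_M | ~~ odd i].
(* I_2 = even-numbered nodes 2,4,... = 0-based indices 1,3,... *)
Definition I_even (M : nat) : {set 'I_M} := [set i : 'I_M | odd i].

(* What a primary does in one channel state: a distribution over subsets
   (supported on independent sets) and a penalty distribution at each node. *)
Record choice (R : realType) (M : nat) := Choice {
  csel : {ffun {set 'I_M} -> R};
  cpen : 'I_M -> probability R R }.

Definition valid_choice (R : realType) (M : nat) (ch : choice R M) : Prop :=
  (forall I, 0 <= csel ch I) /\ (\sum_I csel ch I = 1) /\
  (forall I, csel ch I != 0 -> indep I).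

(* a strategy: one choice for each state j (only j = 1..n matter) *)
Definition strategy (R : realType) (M : nat) := nat -> choice R M.

Definition valid_strategy (R : realType) (M n : nat) (psi : strategy R M) : Prop :=
  forall j, (1 <= j <= n)%N -> valid_choice (psi j).

Definition node_prob (R : realType) (M : nat) (ch : choice R M) (s : 'I_M) : R :=
  \sum_(I : {set 'I_M} | s \in I) csel ch I.

(* For one other primary using psi: probability that it makes an offer at
   node s with penalty < x, resp. = x (averaging over its random state). *)
Definition pi_lt (R : realType) (M n : nat) (q : nat -> R) (psi : strategy R M)
  (s : 'I_M) (x : R) : R :=
  \sum_(1 <= j < n.+1) q j * node_prob (psi j) s * fine (cpen (psi j) s [set y | y < x]).

Definition pi_eq (R : realType) (M n : nat) (q : nat -> R) (psi : strategy R M)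
  (s : 'I_M) (x : R) : R :=
  \sum_(1 <= j < n.+1) q j * node_prob (psi j) s * fine (cpen (psi j) s [set x]).

(* Probability that one's own offer (penalty x <= v) is sold when a other offers
   have strictly lower penalty and b other offers have the same penalty:
   the min(Y,m) lowest are sold, ties broken uniformly at random. *)
Definition sale_share (R : realType) (m a b : nat) : R :=
  if (m <= a)%N then 0 else Num.min 1 ((m - a)%:R / (b.+1)%:R).

(* Probability that one's offer at node s with penalty x <= v is sold, when the
   l-1 other primaries independently use psi.  Each other primary is in one of
   three classes: 0 = offer at s with penalty < x, 1 = penalty = x,
   2 = no offer at s or penalty > x. *)
Definition sale_prob (R : realType) (M l m n : nat) (q : nat -> R)
  (psi : strategy R M) (s : 'I_M) (x : R) : R :=
  let w (k : 'I_3) : R :=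
    if val k == 0%N then pi_lt n q psi s x
    else if val k == 1%N then pi_eq n q psi s x
    else 1 - pi_lt n q psi s x - pi_eq n q psi s x in
  \sum_(cl : {ffun 'I_l.-1 -> 'I_3})
     (\prod_(k : 'I_l.-1) w (cl k)) *
     sale_share R m #|[set k | val (cl k) == 0%N]| #|[set k | val (cl k) == 1%N]|.

Definition node_payoff (R : realType) (M l m n : nat) (q : nat -> R) (c v : R)
  (f : nat -> R -> R) (psi : strategy R M) (j : nat) (s : 'I_M) (x : R) : R :=
  if x <= v then (f j x - c) * sale_prob l m n q psi s x else 0.

Definition payoff (R : realType) (M l m n : nat) (q : nat -> R) (c v : R)
  (f : nat -> R -> R) (psi : strategy R M) (j : nat) (ch : choice R M) : \bar R :=
  (\sum_(I : {set 'I_M}) (csel ch I)%:E *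
     \sum_(s in I) \int[cpen ch s]_x (node_payoff l m n q c v f psi j s x)%:E)%E.

Definition sym_NE (R : realType) (M l m n : nat) (q : nat -> R) (c v : R)
  (f : nat -> R -> R) (psi : strategy R M) : Prop :=
  valid_strategy n psi /\
  forall j, (1 <= j <= n)%N -> forall ch : choice R M, valid_choice ch ->
    (payoff l m n q c v f psi j ch <= payoff l m n q c v f psi j (psi j))%E.

(* equality of strategies: same distribution over independent sets in each
   state, and same penalty distribution at every node that is selected with
   positive probability (the penalty distribution at a never-selected node
   is immaterial) *)
Definition same_strategy (R : realType) (M n : nat) (psi psi' : strategy R M) : Prop :=
  forall j, (1 <= j <= n)%N ->
    csel (psi j) = csel (psi' j) /\
    forall s, 0 < node_prob (psi j) s ->
      forall A : set R, measurable A -> cpen (psi j) s A = cpen (psi' j) s A.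

(* Main.v *)
(** Single crossing of the margins [f j x - c] orders the states at every node:
    higher states quote lower penalties.  The value of state [j] at a node is
    therefore a function of the tails of the masses offered there (the total mass
    of the states [>= j]), and a comparison of tails at two nodes propagates from
    state to state.  Along the path, optimality of the selected independent sets
    then forces each edge to be met with probability one in every state, so only
    the two alternating sets are used.  What is left are the masses put on these
    two sets: whenever the smaller set is used, the sale probabilities on the two
    sets are in the inverse ratio of their cardinals.  This balance condition has
    exactly one solution for each total mass, and indifference recovers the
    penalty laws at a node from the masses. *)
Require Import Defs.
From HB Require Import structures.
From mathcomp Require Import all_boot all_order all_algebra.
From mathcomp Require Import all_classical all_reals all_analysis measurable_realfun.
From mathcomp Require Import ring lra zify.
Set Implicit Arguments. Unset Strict Implicit. Unset Printing Implicit Defensive.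
Import Order.TTheory GRing.Theory Num.Theory.
Import numFieldNormedType.Exports.
Local Open Scope ring_scope.

(** * Sale probability *)

(** Nodes interact only through the choice of independent sets, so a node enters the argument with a
    single sequence, its tails. The obstacle is that exchanging nodes in a set that leaves an edge
    unmet yields only weak inequalities between neighbouring values, and no contradiction at that
    edge. A strict inequality must be carried along the path, and at the same time between states,
    because the states that leave an edge unmet vary from edge to edge. All comparisons of two nodes
    allow a factor [b]: it is 1 for the edges and the ratio of the two cardinals for the balance.
    That this ratio is at least 1 makes the odd set optimal in every state; the even set may be
    abandoned from some state on, which is why balance is an inequality with a complementarity
    clause. For existence, the balance condition is solved separately for each total mass of the
    states [>= k]. The masses of one state are then differences of solutions; they are nonnegative
    because both parts of a balanced split grow with the total. *)

Section SaleProbability.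
Variables (R : realType) (N m : nat).
Hypotheses (m_gt0 : (0 < m)%N) (m_leN : (m <= N)%N).
Implicit Types (w : 'I_3 -> R) (cl : {ffun 'I_N -> 'I_3}).

Definition class_count cl (k : nat) : nat := #|[set i | val (cl i) == k]|.

Definition class_weight (p0 p1 : R) (k : 'I_3) : R :=
  if val k == 0%N then p0 else if val k == 1%N then p1 else 1 - p0 - p1.

Definition tie_sale (p0 p1 : R) : R :=
  \sum_(cl : {ffun 'I_N -> 'I_3}) (\prod_k class_weight p0 p1 (cl k)) *
    sale_share R m (class_count cl 0) (class_count cl 1).

(** A binomial tail: without ties the offer is sold exactly when fewer than [m] of the [N] others
    undercut it, each independently with probability [p]. *)
Definition sale (p : R) : R := tie_sale p 0.

(** Independent classes stay independent under a relabelling [t], with weights pushed forward along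
    [t]. This puts different conventions about ties on one probability space, where they can be
    compared outcome by outcome. *)
Lemma relabel_sum (t : 'I_3 -> 'I_3) w w' (H : {ffun 'I_N -> 'I_3} -> R) :
  (forall c, w' c = \sum_(b | t b == c) w b) ->
  \sum_(cl : {ffun 'I_N -> 'I_3}) (\prod_k w' (cl k)) * H cl =
  \sum_(cl : {ffun 'I_N -> 'I_3}) (\prod_k w (cl k)) * H [ffun k => t (cl k)].
Proof.
move=> ww'.
rewrite [RHS](partition_big (fun cl : {ffun 'I_N -> 'I_3} => [ffun k => t (cl k)]) predT) //=.
apply: eq_bigr => cl' _.
under [RHS]eq_bigr => cl /eqP -> do [].
rewrite -big_distrl /=; congr (_ * _).
under eq_bigr do rewrite ww'.
rewrite bigA_distr_big_dep /=; apply: eq_bigl => cl.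
apply/familyP/eqP => [h|<- k]; last by rewrite ffunE unfold_in.
by apply/ffunP => k; rewrite ffunE; apply/eqP/h.
Qed.

Lemma sale_share_ge0 a b : 0 <= sale_share R m a b.
Proof.
by rewrite /sale_share; case: ifP.
Qed.

Lemma sale_share_le1 a b : sale_share R m a b <= 1.
Proof. by rewrite /sale_share; case: ifP => // _; rewrite ge_min lexx. Qed.

Lemma sale_share1 a b : (a + b < m)%N -> sale_share R m a b = 1.
Proof.
move=> ab; rewrite /sale_share leqNgt (leq_ltn_trans (leq_addr b a) ab) /=.
apply/min_idPl; rewrite ler_pdivlMr ?ltr0n // mul1r ler_nat; lia.
Qed.

Lemma sale_share0 a b : (m <= a)%N -> sale_share R m a b = 0.
Proof. by rewrite /sale_share => ->. Qed.

(** When everybody ties, [m] sales are shared by [N + 1] offers, and [m <= N]. *)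
Lemma sale_share_tie : sale_share R m 0 N < 1.
Proof.
rewrite /sale_share leqNgt m_gt0 /= gt_min; apply/orP; right.
rewrite ltr_pdivrMr ?ltr0n // mul1r ltr_nat; lia.
Qed.

Lemma class_weight_ge0 p0 p1 k : 0 <= p0 -> 0 <= p1 -> p0 + p1 <= 1 ->
  0 <= class_weight p0 p1 k.
Proof. by move=> ? ? ?; rewrite /class_weight; do 2?case: ifP => // _; lra. Qed.

Lemma sum_class_weight (P : pred 'I_3) p0 p1 : \sum_(b | P b) class_weight p0 p1 b =
  (if P (inord 0) then p0 else 0) + (if P (inord 1) then p1 else 0) +
  (if P (inord 2) then 1 - p0 - p1 else 0).
Proof.
rewrite big_mkcond /= !big_ord_recl big_ord0 /class_weight /= addr0 addrA.
do 2?[congr (_ + _)]; congr (if P _ then _ else _); apply: val_inj => /=; by rewrite inordK.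
Qed.

Definition cl_merge (a b k : 'I_3) : 'I_3 := if k == a then b else k.

Lemma ord3_cases (c : 'I_3) : [\/ c = inord 0, c = inord 1 | c = inord 2].
Proof.
by case: c => -[|[|[|//]]] i; [constructor 1|constructor 2|constructor 3];
  apply: val_inj; rewrite /= inordK.
Qed.

Lemma eq_inord3 i j : (i < 3)%N -> (j < 3)%N -> ((inord i : 'I_3) == inord j) = (i == j).
Proof. by move=> i3 j3; rewrite -val_eqE /= !inordK. Qed.

(** Tied offers are counted as absent: class 1 is relabelled 2. *)
Lemma tie_sale_drop p0 p1 : sale p0 =
  \sum_(cl : {ffun 'I_N -> 'I_3}) (\prod_k class_weight p0 p1 (cl k)) * sale_share R m (class_count cl 0) 0.
Proof.
rewrite /sale /tie_sale.
rewrite (relabel_sum (t := cl_merge (inord 1) (inord 2)) (w := class_weight p0 p1)); last first.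
  move=> c; rewrite sum_class_weight /class_weight /cl_merge !eq_inord3 //=.
  by case: (ord3_cases c) => ->; rewrite ?inordK ?eq_inord3 //=; ring.
apply: eq_bigr => cl _; congr (_ * sale_share R m _ _).
  apply: eq_card => k; rewrite !inE ffunE /cl_merge.
  by case: (cl k =P inord 1) => [->|] /=; rewrite ?inordK.
rewrite -[RHS](cards0 'I_N); apply: eq_card => k; rewrite !inE ffunE /cl_merge.
case: (cl k =P inord 1) => [_|nk] /=; rewrite ?inordK //.
by apply/negbTE/eqP => h; apply: nk; apply: val_inj; rewrite /= inordK.
Qed.

(** The opposite convention: tied offers are counted as lower, class 1 being relabelled 0. The true
    tie rule lies between the two in every outcome. *)
Lemma tie_sale_merge p0 p1 : sale (p0 + p1) =
  \sum_(cl : {ffun 'I_N -> 'I_3}) (\prod_k class_weight p0 p1 (cl k)) *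
    sale_share R m (class_count cl 0 + class_count cl 1) 0.
Proof.
rewrite /sale /tie_sale.
rewrite (relabel_sum (t := cl_merge (inord 1) (inord 0)) (w := class_weight p0 p1)); last first.
  move=> c; rewrite sum_class_weight /class_weight /cl_merge !eq_inord3 //=.
  by case: (ord3_cases c) => ->; rewrite ?inordK ?eq_inord3 //=; ring.
apply: eq_bigr => cl _; congr (_ * sale_share R m _ _).
  rewrite /class_count -cardsUI [X in (_ = _ + X)%N]eq_card0 ?addn0; last first.
    by move=> k; rewrite !inE; case: (val (cl k)) => [|[|?]].
  apply: eq_card => k; rewrite !inE ffunE /cl_merge.
  case: (cl k =P inord 1) => [->|nk] /=; rewrite ?inordK //=.
  suff -> : (nat_of_ord (cl k) == 1%N) = false by rewrite orbF.
  by apply/negbTE/eqP => h; apply: nk; apply: val_inj; rewrite /= inordK.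
rewrite -[RHS](cards0 'I_N); apply: eq_card => k; rewrite !inE ffunE /cl_merge.
case: (cl k =P inord 1) => [_|nk] /=; rewrite ?inordK //.
by apply/negbTE/eqP => h; apply: nk; apply: val_inj; rewrite /= inordK.
Qed.

Section Bounds.
Variables (p0 p1 : R).
Hypotheses (p0_ge0 : 0 <= p0) (p1_ge0 : 0 <= p1) (p01_le1 : p0 + p1 <= 1).

Let weights_ge0 cl : 0 <= \prod_k class_weight p0 p1 (cl k).
Proof. by apply: prodr_ge0 => k _; exact: class_weight_ge0. Qed.

Lemma tie_sale_le : tie_sale p0 p1 <= sale p0.
Proof.
rewrite (tie_sale_drop p0 p1); apply: ler_sum => cl _; apply: ler_wpM2l => //.
have [a_m|m_a] := ltnP (class_count cl 0) m; last by rewrite !sale_share0.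
by rewrite [leRHS]sale_share1 ?addn0 // sale_share_le1.
Qed.

Lemma tie_sale_ge : sale (p0 + p1) <= tie_sale p0 p1.
Proof.
rewrite tie_sale_merge; apply: ler_sum => cl _; apply: ler_wpM2l => //.
have [ab_m|m_ab] := ltnP (class_count cl 0 + class_count cl 1) m.
  by rewrite !sale_share1 ?addn0.
by rewrite [leLHS]sale_share0 // sale_share_ge0.
Qed.

(** Strictness comes from the outcome in which all [N] others tie, whose weight is a power of
    [p1]. *)
Lemma tie_sum_lt (H H' : {ffun 'I_N -> 'I_3} -> R) : 0 < p1 ->
  (forall cl, H cl <= H' cl) ->
  (forall cl, class_count cl 0 = 0%N -> class_count cl 1 = N -> H cl < H' cl) ->
  \sum_(cl : {ffun 'I_N -> 'I_3}) (\prod_k class_weight p0 p1 (cl k)) * H cl <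
  \sum_(cl : {ffun 'I_N -> 'I_3}) (\prod_k class_weight p0 p1 (cl k)) * H' cl.
Proof.
move=> p1_gt0 HH' HH'lt; pose cl1 : {ffun 'I_N -> 'I_3} := [ffun=> inord 1].
rewrite (bigD1 cl1) // [ltRHS](bigD1 cl1) //=; apply: ltr_leD.
  rewrite ltr_pM2l; last first.
    by apply: prodr_gt0 => k _; rewrite ffunE /class_weight /= inordK.
  apply: HH'lt.
    rewrite /class_count -[RHS](cards0 'I_N); apply: eq_card => k.
    by rewrite !inE ffunE /= inordK.
  rewrite /class_count -[RHS](card_ord N) -cardsT; apply: eq_card => k.
  by rewrite !inE ffunE /= inordK.
by apply: ler_sum => cl _; apply: ler_wpM2l.
Qed.

Lemma tie_sale_lt : 0 < p1 -> tie_sale p0 p1 < sale p0.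
Proof.
move=> p1_gt0; rewrite (tie_sale_drop p0 p1); apply: tie_sum_lt => // cl.
  have [a_m|m_a] := ltnP (class_count cl 0) m; last by rewrite !sale_share0.
  by rewrite [leRHS]sale_share1 ?addn0 // sale_share_le1.
by move=> -> ->; rewrite [ltRHS]sale_share1 ?addn0 // sale_share_tie.
Qed.

Lemma sale_lt_add : 0 < p1 -> sale (p0 + p1) < sale p0.
Proof.
move=> p1_gt0; rewrite (tie_sale_drop p0 p1) tie_sale_merge; apply: tie_sum_lt => // cl.
  have [ab_m|m_ab] := ltnP (class_count cl 0 + class_count cl 1) m.
    by rewrite !sale_share1 ?addn0 // (leq_ltn_trans (leq_addr _ _) ab_m).
  by rewrite [leLHS]sale_share0 // sale_share_ge0.
by move=> -> ->; rewrite [ltLHS]sale_share0 // [ltRHS]sale_share1 ?addn0.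
Qed.

End Bounds.

Lemma sale_decr p p' : 0 <= p -> p < p' -> p' <= 1 -> sale p' < sale p.
Proof.
move=> p_ge0 pp' p'_le1; rewrite (_ : p' = p + (p' - p)); last by ring.
by apply: sale_lt_add; lra.
Qed.

Lemma sale_gt0 p : 0 <= p -> p < 1 -> 0 < sale p.
Proof.
move=> p_ge0 p_lt1; pose cl2 : {ffun 'I_N -> 'I_3} := [ffun=> inord 2].
rewrite /sale /tie_sale (bigD1 cl2) //=; apply: ltr_pwDl.
  apply: mulr_gt0.
    by apply: prodr_gt0 => k _; rewrite ffunE /class_weight /= inordK //=; lra.
  rewrite sale_share1 // /class_count !eq_card0 // => k;
  by rewrite !inE ffunE /= inordK.
apply: sumr_ge0 => cl _; apply: mulr_ge0; last exact: sale_share_ge0.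
by apply: prodr_ge0 => k _; apply: class_weight_ge0 => //; lra.
Qed.

Lemma sale0 : sale 0 = 1.
Proof.
pose cl2 : {ffun 'I_N -> 'I_3} := [ffun=> inord 2].
rewrite /sale /tie_sale (bigD1 cl2) //= [X in _ + X]big1 ?addr0.
  rewrite big1; last by move=> k _; rewrite ffunE /class_weight /= inordK //=; ring.
  rewrite mul1r sale_share1 // /class_count !eq_card0 // => k;
  by rewrite !inE ffunE /= inordK.
move=> cl ncl; have [k hk] : exists k, cl k != inord 2.
  apply/existsP; apply: contraNT ncl => /existsPn h; apply/eqP/ffunP => k.
  by rewrite ffunE; apply/eqP/negPn/h.
suff -> : \prod_k class_weight 0 0 (cl k) = 0 by rewrite mul0r.
apply/eqP/prodf_eq0; exists k => //; rewrite /class_weight.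
by move: hk; case: (ord3_cases (cl k)) => -> /=; rewrite ?inordK // eqxx.
Qed.

(** Each summand is a constant times a product of factors [p], 0 and [1 - p], so [sale] is a
    polynomial function. *)
Lemma continuous_sale : continuous sale.
Proof.
pose P : {poly R} := \sum_(cl : {ffun 'I_N -> 'I_3}) (\prod_k
   (if val (cl k) == 0%N then 'X else if val (cl k) == 1%N then 0 else 1 - 'X)) *
    (sale_share R m (class_count cl 0) (class_count cl 1))%:P.
suff -> : sale = horner P by exact: continuous_horner.
apply/funext => p; rewrite /sale /tie_sale /P horner_sum; apply: eq_bigr => cl _.
rewrite hornerM hornerC horner_prod; congr (_ * _); apply: eq_bigr => k _.
rewrite /class_weight; case: ifP => _; first by rewrite hornerX.
by case: ifP => _; rewrite !hornerE ?subr0.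
Qed.

End SaleProbability.

(** * Indifference penalties and node values *)

(* [lia] preprocesses the whole context, which is slow next to real-valued
   hypotheses; only index inequalities are kept. *)
Ltac nat_lia :=
  repeat match goal with
  | H : ?P |- _ => lazymatch P with
    | nat => fail
    | is_true (leq _ _) => fail
    | is_true (_ && _) => fail
    | is_true (~~ _) => fail
    | @eq nat _ _ => fail
    | _ => clear H
    end
  end; lia.

Section Breakpoints.
Variables (R : realType) (c v : R) (g f : nat -> R -> R) (phi : R -> R).

(* Offers of state [j] fill the interval between [brk T j] and [brk T j.-1]; state
   [j] is indifferent between its two endpoints. *)
Fixpoint brk (T : nat -> R) (j : nat) : R :=
  if j is k.+1 then g j (c + (f j (brk T k) - c) * phi (T j) / phi (T j.+1)) else v.

(** Read at the top of the interval of state [j], where the lower offers are exactly those of the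
    states [>= j]. Only [T 1], ..., [T j] enter, which permits induction on the state. *)
Definition nodeval (T : nat -> R) (j : nat) : R := (f j (brk T j.-1) - c) * phi (T j).

Lemma brk_ext T T' j : (forall k, (1 <= k <= j.+1)%N -> T k = T' k) -> brk T j = brk T' j.
Proof.
elim: j => // j IH eqT /=; rewrite IH => [|k hk]; last by apply: eqT; lia.
by rewrite !eqT //; lia.
Qed.

Lemma nodeval_ext T T' j : (1 <= j)%N -> (forall k, (1 <= k <= j)%N -> T k = T' k) ->
  nodeval T j = nodeval T' j.
Proof.
by case: j => // j _ eqT; rewrite /nodeval (@brk_ext T T') // eqT //; lia.
Qed.

End Breakpoints.

Record regular_market (R : realType) (n : nat) (c v : R) (g f : nat -> R -> R) : Prop :=
  RegularMarket {
  market_incr : forall j, (1 <= j <= n)%N -> forall p p', p < p' -> g j p < g j p';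
  market_fg : forall j, (1 <= j <= n)%N -> forall p, f j (g j p) = p;
  market_gf : forall j, (1 <= j <= n)%N -> forall x, g j (f j x) = x;
  market_order : forall i j, (1 <= j)%N -> (j < i)%N -> (i <= n)%N ->
    forall p, g i p < g j p;
  market_ratio : forall i j, (1 <= i)%N -> (i < j)%N -> (j <= n)%N ->
    forall x y, g i c < y -> y < x ->
      (f i y - c) / (f j y - c) < (f i x - c) / (f j x - c);
  market_v : c < f 1%N v }.

Record sale_curve (R : realType) (phi : R -> R) : Prop := SaleCurve {
  curve_decr : forall p p', 0 <= p -> p < p' -> p' <= 1 -> phi p' < phi p;
  curve_gt0 : forall p, 0 <= p -> p < 1 -> 0 < phi p;
  curve0 : phi 0 = 1;
  curve_cont : continuous phi }.

Section NodeValues.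
Variables (R : realType) (n : nat) (c v : R) (g f : nat -> R -> R) (phi : R -> R).
Hypotheses (mk : regular_market n c v g f) (sc : sale_curve phi).
Let hg_incr := market_incr mk.
Let hfg := market_fg mk.
Let hgf := market_gf mk.
Let hg_order := market_order mk.
Let hratio := market_ratio mk.
Let hf1v := market_v mk.
Let phi_decr := curve_decr sc.
Let phi_gt0 := curve_gt0 sc.

Lemma f_incr j : (1 <= j <= n)%N -> {mono f j : x y / x < y}.
Proof.
move=> hj; apply: leW_mono; apply: le_mono => x y xy; rewrite ltNge; apply/negP.
rewrite le_eqVlt => /orP[/eqP e|/(hg_incr hj)]; last by rewrite !hgf // ltNge ltW.
by have := congr1 (g j) e; rewrite !hgf // => yx; rewrite yx ltxx in xy.
Qed.

Lemma f_incr_le j : (1 <= j <= n)%N -> {mono f j : x y / x <= y}.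
Proof. by move=> hj x y; rewrite !leNgt f_incr. Qed.

Lemma f_state i j x : (1 <= i)%N -> (i < j)%N -> (j <= n)%N -> f i x < f j x.
Proof.
move=> i1 ij jn; have hj : (1 <= j <= n)%N by lia.
have hi : (1 <= i <= n)%N by lia.
have lt_x : g j (f i x) < x by rewrite -[ltRHS](hgf hi) hg_order.
by rewrite -[ltLHS](hfg hj) f_incr.
Qed.

Lemma g_lt j p x : (1 <= j <= n)%N -> (g j p < x) = (p < f j x).
Proof. by move=> hj; rewrite -[in RHS](hfg hj p) f_incr. Qed.

(** The ratio hypothesis cleared of its denominators, which are positive because a higher state has
    the larger margin. *)
Lemma margin_ratio i j x y : (1 <= i)%N -> (i < j)%N -> (j <= n)%N ->
  c < f i y -> y < x -> (f i y - c) * (f j x - c) < (f i x - c) * (f j y - c).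
Proof.
move=> i1 ij jn cy yx; have hi : (1 <= i <= n)%N by lia.
have hj : (1 <= j <= n)%N by lia.
have gcy : g i c < y by rewrite g_lt.
have fjy : 0 < f j y - c by have := f_state y i1 ij jn; lra.
have fjx : 0 < f j x - c by have : f j y < f j x by [rewrite f_incr]; lra.
have := hratio i1 ij jn gcy yx.
by rewrite ltr_pdivrMr // mulrAC ltr_pdivlMr.
Qed.

Lemma margin_ratio_le i j x y : (1 <= i)%N -> (i <= j)%N -> (j <= n)%N ->
  c < f i y -> y <= x -> (f i y - c) * (f j x - c) <= (f i x - c) * (f j y - c).
Proof.
move=> i1; rewrite [(i <= j)%N]leq_eqVlt => /predU1P[-> _ _ _|ij jn cy].
  by rewrite mulrC.
by rewrite le_eqVlt => /predU1P[->//|yx]; rewrite ltW // margin_ratio.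
Qed.

Section OneNode.
Variable T : nat -> R.
Hypothesis hT : forall j, (1 <= j <= n.+1)%N -> 0 <= T j < 1.
Local Notation B := (brk c v g f phi T).
Local Notation V := (nodeval c v g f phi T).

Let phiT j : (1 <= j <= n.+1)%N -> 0 < phi (T j).
Proof. by move=> /hT/andP[]; exact: phi_gt0. Qed.

Lemma f_brk j : (1 <= j <= n)%N ->
  f j (B j) - c = (f j (B j.-1) - c) * phi (T j) / phi (T j.+1).
Proof. by case: j => // j hj /=; rewrite hfg //; ring. Qed.

(** Going down one interval multiplies the margin of a state by a positive ratio of sale
    probabilities, and passing to the next state enlarges the margin, so it never reaches 0. *)
Lemma brk_gt j : (1 <= j <= n)%N -> c < f j (B j.-1).
Proof.
case: j => // j; elim: j => [//|j IH] hj.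
have hj' : (1 <= j.+1 <= n)%N by lia.
have cj : c < f j.+1 (B j.+1).
  rewrite -subr_gt0 f_brk //; apply: divr_gt0; last by apply: phiT; lia.
  by apply: mulr_gt0; [rewrite subr_gt0; exact: IH|apply: phiT; lia].
by apply: lt_trans cj _; apply: f_state => //; lia.
Qed.

Lemma brk_gt' j : (1 <= j <= n)%N -> c < f j (B j).
Proof.
move=> hj; rewrite -subr_gt0 f_brk //; apply: divr_gt0; last by apply: phiT; lia.
by apply: mulr_gt0; [rewrite subr_gt0; exact: brk_gt|apply: phiT; lia].
Qed.

(** Indifference between the two endpoints: at the lower one only the states above [j] undercut. *)
Lemma nodevalE j : (1 <= j <= n)%N -> (f j (B j) - c) * phi (T j.+1) = V j.
Proof.
by move=> hj; rewrite f_brk // /nodeval divfK // gt_eqF //; apply: phiT; lia.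
Qed.

Lemma nodeval_gt0 j : (1 <= j <= n)%N -> 0 < V j.
Proof.
by move=> hj; apply: mulr_gt0; [rewrite subr_gt0; exact: brk_gt|apply: phiT; lia].
Qed.

Lemma brk_anti j : (1 <= j <= n)%N -> T j.+1 <= T j -> B j <= B j.-1.
Proof.
move=> hj Tj; rewrite -(f_incr_le hj) -(lerD2r (- c)) f_brk //.
have hj1 : (1 <= j.+1 <= n.+1)%N by lia.
have hj0 : (1 <= j <= n.+1)%N by lia.
rewrite ler_pdivrMr ?phiT // ler_pM2l ?subr_gt0 ?brk_gt //.
move: Tj; rewrite le_eqVlt => /predU1P[->//|Tj]; apply/ltW/phi_decr => //.
  by have /andP[] := hT hj1.
by have /andP[_ /ltW] := hT hj0.
Qed.

End OneNode.

(** * Comparison of the values at two nodes *)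

Section TwoNodes.
Variables (T T' : nat -> R) (b : R).
Hypothesis b_gt0 : 0 < b.
Hypothesis hT : forall j, (1 <= j <= n.+1)%N -> 0 <= T j < 1.
Hypothesis hT' : forall j, (1 <= j <= n.+1)%N -> 0 <= T' j < 1.
Local Notation B := (brk c v g f phi).
Local Notation V := (nodeval c v g f phi).

Variable k : nat.
Hypotheses (k_gt0 : (1 <= k)%N) (k_ltn : (k < n)%N).
Let hk : (1 <= k <= n)%N. Proof. by lia. Qed.
Let hk1 : (1 <= k.+1 <= n)%N. Proof. by lia. Qed.
Let phiT : 0 < phi (T k.+1).
Proof. by have /hT/andP[] : (1 <= k.+1 <= n.+1)%N by [lia]; exact: phi_gt0. Qed.
Let phiT' : 0 < phi (T' k.+1).
Proof. by have /hT'/andP[] : (1 <= k.+1 <= n.+1)%N by [lia]; exact: phi_gt0. Qed.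

(** If the primed node has the higher breakpoint, state [k] gains relatively more from it than state
    [k.+1] does. The factors [phi (T k.+1)] and [phi (T' k.+1)] are common to the values in both
    states, so a weak inequality in state [k] becomes strict in state [k.+1], whatever the order of
    the tails. *)
Let crossing : B T k < B T' k ->
  V T' k <= b * V T k -> V T' k.+1 < b * V T k.+1.
Proof.
move=> lt_brk; rewrite -(nodevalE hT hk) -(nodevalE hT' hk) /nodeval /=.
have := margin_ratio k_gt0 (ltnSn k) k_ltn (brk_gt' hT hk) lt_brk.
have := brk_gt' hT hk; have := brk_gt' hT' hk.
have := brk_gt hT hk1; have := brk_gt hT' hk1; rewrite /=.
rewrite -/(B T k) -/(B T' k).
set a := f k (B T k); set a' := f k (B T' k).
set d := f k.+1 (B T k); set d' := f k.+1 (B T' k).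
move=> d'c dc a'c ac r le_val.
rewrite -(@ltr_pM2r _ (a - c)) ?subr_gt0 //.
rewrite [X in X < _](_ : _ = ((a - c) * (d' - c)) * phi (T' k.+1)); last by ring.
apply: lt_le_trans (_ : (a' - c) * (d - c) * phi (T' k.+1) <= _).
  by rewrite ltr_pM2r.
rewrite [X in X <= _](_ : _ = (a' - c) * phi (T' k.+1) * (d - c)); last by ring.
rewrite [X in _ <= X](_ : _ = b * ((a - c) * phi (T k.+1)) * (d - c)); last by ring.
by rewrite ler_pM2r ?subr_gt0.
Qed.

Let direct : B T' k <= B T k ->
  phi (T' k.+1) <= b * phi (T k.+1) -> V T' k.+1 <= b * V T k.+1.
Proof.
move=> le_brk le_phi; rewrite /nodeval /= mulrCA.
apply: ler_pM => //; try exact: ltW; first by rewrite subr_ge0 ltW // (brk_gt hT' hk1).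
by rewrite lerD2r (f_incr_le hk1).
Qed.

(* Up to a common scaling, the value in state k.+1 lies between the value in
   state k and the probability of sale at the common breakpoint. *)
Lemma nodeval_step : V T' k <= b * V T k ->
  phi (T' k.+1) <= b * phi (T k.+1) -> V T' k.+1 <= b * V T k.+1.
Proof.
move=> le_val le_phi; have [le_brk|lt_brk] := leP (B T' k) (B T k).
  exact: direct.
by apply/ltW/crossing.
Qed.

(** Strictness comes from [crossing] or from the strictly larger margin when the breakpoints differ.
    When they agree, both nodes have equal margins in each of the states [k] and [k.+1], so the two
    comparisons reduce to the same comparison of [phi]. *)
Lemma nodeval_step_ltl : V T' k < b * V T k ->
  phi (T' k.+1) <= b * phi (T k.+1) -> V T' k.+1 < b * V T k.+1.
Proof.
move=> lt_val le_phi; have [lt_brk|lt_brk|eq_brk] := ltgtP (B T' k) (B T k).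
- rewrite /nodeval /= mulrCA; apply: (@lt_le_trans _ _ ((f k.+1 (B T k) - c) * phi (T' k.+1))).
    by rewrite ltr_pM2r // ltrD2r (f_incr hk1).
  by rewrite ler_pM2l // subr_gt0 (brk_gt hT hk1).
- exact/crossing/ltW.
- move: lt_val; rewrite -(nodevalE hT hk) -(nodevalE hT' hk) /nodeval /= -/(B T k) -/(B T' k) eq_brk !(mulrCA b).
  by rewrite !ltr_pM2l // subr_gt0; [exact: (brk_gt hT hk1)|exact: brk_gt'].
Qed.

Lemma nodeval_step_ltr : V T' k <= b * V T k ->
  phi (T' k.+1) < b * phi (T k.+1) -> V T' k.+1 < b * V T k.+1.
Proof.
move=> le_val lt_phi; have [le_brk|lt_brk] := leP (B T' k) (B T k); last exact: crossing.
rewrite /nodeval /= mulrCA.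
apply: (@le_lt_trans _ _ ((f k.+1 (B T k) - c) * phi (T' k.+1))).
  by rewrite ler_pM2r // lerD2r (f_incr_le hk1).
by rewrite ltr_pM2l // subr_gt0 (brk_gt hT hk1).
Qed.

End TwoNodes.

Lemma curve_anti p p' : 0 <= p -> p <= p' -> p' <= 1 -> phi p' <= phi p.
Proof.
move=> p_ge0; rewrite le_eqVlt => /predU1P[->//|pp'] p'_le1.
by apply/ltW/phi_decr.
Qed.

Lemma curve_inj p p' : 0 <= p <= 1 -> 0 <= p' <= 1 -> phi p = phi p' -> p = p'.
Proof.
move=> /andP[p0 p1] /andP[p'0 p'1] e; have [h|h|//] := ltgtP p p'.
  by have := phi_decr p0 h p'1; rewrite e ltxx.
by have := phi_decr p'0 h p1; rewrite e ltxx.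
Qed.

Lemma curve_ltP p p' : 0 <= p <= 1 -> 0 <= p' <= 1 -> (phi p < phi p') = (p' < p).
Proof.
move=> /andP[p0 p1] /andP[p'0 p'1]; have [h|h|->] := ltgtP p' p; last by rewrite ltxx.
  exact: phi_decr.
by apply/negbTE; rewrite -leNgt ltW // phi_decr.
Qed.

Lemma curve_leP p p' : 0 <= p <= 1 -> 0 <= p' <= 1 -> (phi p <= phi p') = (p' <= p).
Proof. by move=> hp hp'; rewrite !leNgt curve_ltP. Qed.

End NodeValues.

Lemma sale_curve_sale (R : realType) (N m : nat) :
  (0 < m)%N -> (m <= N)%N -> sale_curve (@sale R N m).
Proof.
move=> m0 mN; split; [exact: sale_decr|exact: sale_gt0|exact: sale0|exact: continuous_sale].
Qed.

(** * Tight edges and balance *)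

Section Tightness.
(** [W i t] and [T i t] stand for the value and the tail of state [i] at node [t], and [dm i t] for
    the mass that state [i] puts on sets avoiding both [t] and [t.+1]. *)
Variables (R : realType) (n M : nat) (W T dm : nat -> nat -> R).
Hypothesis W1 : forall s t, (s < M)%N -> (t < M)%N -> T 1%N t <= T 1%N s -> W 1%N s <= W 1%N t.
Hypothesis W1lt : forall s t, (s < M)%N -> (t < M)%N -> T 1%N t < T 1%N s -> W 1%N s < W 1%N t.
Hypothesis step : forall i s t, (1 <= i)%N -> (i < n)%N -> (s < M)%N -> (t < M)%N ->
  W i s <= W i t -> T i.+1 t <= T i.+1 s -> W i.+1 s <= W i.+1 t.
Hypothesis step_lt : forall i s t, (1 <= i)%N -> (i < n)%N -> (s < M)%N -> (t < M)%N ->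
  W i s < W i t -> T i.+1 t <= T i.+1 s -> W i.+1 s < W i.+1 t.
Hypothesis dm_ge0 : forall i t, 0 <= dm i t.
Hypothesis T_diff : forall i t, (1 <= i <= n)%N -> (t.+2 < M)%N ->
  T i t - T i t.+2 = \sum_(i <= k < n.+1) (dm k t.+1 - dm k t).
Hypothesis dm_pos : forall i t, (1 <= i <= n)%N -> (t.+1 < M)%N -> 0 < dm i t ->
  [/\ (0 < t)%N, (t.+2 < M)%N, W i t <= W i t.-1 & W i t.+1 <= W i t.+2].

Let propagate i0 i s t : (1 <= i0 <= i)%N -> (i <= n)%N -> (s < M)%N -> (t < M)%N ->
  W i0 s <= W i0 t -> (forall k, (i0 < k <= i)%N -> T k t <= T k s) -> W i s <= W i t.
Proof.
move=> /andP[i01]; elim: i => [|i IH] i0i i_n sM tM W0 hT; first by nat_lia.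
have [e|ne] := eqVneq i0 i.+1; first by rewrite -e.
apply: step => //; try nat_lia; last by apply: hT; nat_lia.
by apply: IH => //; try nat_lia; move=> k hk; apply: hT; nat_lia.
Qed.

Let propagate_lt i0 i s t : (1 <= i0 <= i)%N -> (i <= n)%N -> (s < M)%N -> (t < M)%N ->
  W i0 s < W i0 t -> (forall k, (i0 < k <= i)%N -> T k t <= T k s) -> W i s < W i t.
Proof.
move=> /andP[i01]; elim: i => [|i IH] i0i i_n sM tM W0 hT; first by nat_lia.
have [e|ne] := eqVneq i0 i.+1; first by rewrite -e.
apply: step_lt => //; try nat_lia; last by apply: hT; nat_lia.
by apply: IH => //; try nat_lia; move=> k hk; apply: hT; nat_lia.
Qed.

Let deficient t := [exists i : 'I_n.+1, (0 < i)%N && (0 < dm i t)].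

Let top_state t : deficient t -> exists j, [/\ (1 <= j <= n)%N, 0 < dm j t &
  forall i, (j < i <= n)%N -> dm i t = 0].
Proof.
move=> /existsP[i0 /andP[i00 di0]].
have ex : exists i, (1 <= i <= n)%N && (0 < dm i t) by exists i0; rewrite i00 -ltnS ltn_ord di0.
have ub i : (1 <= i <= n)%N && (0 < dm i t) -> (i <= n)%N by nat_lia.
case: (ex_maxnP ex ub) => j /andP[hj dj] max_j; exists j; split => // i hi.
apply/eqP; rewrite eq_le dm_ge0 andbT leNgt; apply/negP => di.
by have := max_j i; rewrite di andbT; nat_lia.
Qed.

Let not_deficient t i : ~~ deficient t -> (1 <= i <= n)%N -> dm i t = 0.
Proof.
move=> nd hi; apply/eqP; rewrite eq_le dm_ge0 andbT leNgt; apply: contra nd => di.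
apply/existsP; have i_n : (i < n.+1)%N by nat_lia.
by exists (Ordinal i_n); rewrite /= di andbT; nat_lia.
Qed.

Let T_le i t : (1 <= i <= n)%N -> (t.+2 < M)%N ->
  (forall k, (i <= k <= n)%N -> dm k t.+1 = 0) -> T i t <= T i t.+2.
Proof.
move=> hi tM h; rewrite -subr_le0 T_diff // big_nat_cond; apply: sumr_le0 => k.
by move=> hk; rewrite h ?sub0r ?oppr_le0 //; nat_lia.
Qed.

Let T_ge i t : (1 <= i <= n)%N -> (t.+2 < M)%N ->
  (forall k, (i <= k <= n)%N -> dm k t = 0) -> T i t.+2 <= T i t.
Proof.
move=> hi tM h; rewrite -subr_ge0 T_diff // big_nat_cond; apply: sumr_ge0 => k.
by move=> hk; rewrite h ?subr0 //; nat_lia.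
Qed.

(** The invariant carried along the path. Taking the highest state [j] that leaves the edge unmet
    ensures that above [j] this edge contributes nothing to the differences of tails. *)
Let rising t := (t.+1 < M)%N /\ exists j, [/\ (1 <= j <= n)%N, 0 < dm j t,
  forall i, (j < i <= n)%N -> dm i t = 0 & W j t < W j t.+2].

(** Were the next edge met in all states, the tails could only grow from [t] to [t.+2], against the
    rise in value; so it has a top state [j']. If [j <= j'], the rise is carried up from [j] to
    [j']; if [j' < j], its failure in [j'] would be carried up to [j]. The exchange inequalities for
    [j'] then shift the rise by one node. *)
Let rising_next t : rising t -> rising t.+1.
Proof.
move=> [tM [j [hj dj top_j Wj]]]; have [t0 t2M _ Wj2] := dm_pos hj tM dj.
have t'M : (t < M)%N by nat_lia.
have [def|ndef] := boolP (deficient t.+1); last first.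
  have le_T k : (1 <= k <= n)%N -> T k t <= T k t.+2.
    by move=> hk; apply: T_le => // i hi; apply: not_deficient => //; nat_lia.
  have : W j t.+2 <= W j t.
    apply: (@propagate 1%N) => //; try nat_lia.
      by apply: W1 => //; apply: le_T; nat_lia.
    by move=> k hk; apply: le_T; nat_lia.
  by rewrite leNgt Wj.
have [j' [hj' dj' top_j']] := top_state def.
have [_ t3M Wj'0 Wj'2] := dm_pos hj' t2M dj'.
split => //; exists j'; split => //.
suff lt_j' : W j' t < W j' t.+2.
  by apply: le_lt_trans Wj'0 _; apply: lt_le_trans lt_j' _.
have [jj'|j'j] := leqP j j'.
  apply: (@propagate_lt j) => //; try nat_lia.
  by move=> k hk; apply: T_ge => //; [nat_lia|move=> i hi; apply: top_j; nat_lia].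
rewrite ltNge; apply/negP => le_j'.
have : W j t.+2 <= W j t.
  apply: (@propagate j') => //; try nat_lia.
  by move=> k hk; apply: T_le => //; [nat_lia|move=> i hi; apply: top_j'; nat_lia].
by rewrite leNgt Wj.
Qed.

(* On the first deficient edge the best deficient state sees values rising to
   the right; such a rise propagates along the path and runs off its end. *)
Lemma all_edges_tight i t : (1 <= i <= n)%N -> (t.+1 < M)%N -> dm i t = 0.
Proof.
move=> hi tM; apply: not_deficient => //; apply/negP => def_t.
have no_rising s : ~ rising s.
  move=> rs; have rs_add k : rising (s + k).
    by elim: k => [|k IH]; rewrite ?addn0 ?addnS //; exact: rising_next.
  by case: (rs_add M) => + _; nat_lia.
have exs : exists s, (s.+1 < M)%N && deficient s by exists t; rewrite tM.
case: (ex_minnP exs) => s /andP[sM def_s] min_s.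
apply: (no_rising s); split => //.
have [j [hj dj top_j]] := top_state def_s; exists j; split => //.
have [s0 s2M Wj0 Wj2] := dm_pos hj sM dj.
case: s => // s in sM def_s min_s dj top_j s0 s2M Wj0 Wj2 *.
have ndef_s : ~~ deficient s.
  by apply/negP => def; have := min_s s; rewrite def andbT; nat_lia.
have z_s k : (1 <= k <= n)%N -> dm k s = 0 by exact: not_deficient.
(* Edge [s] is met in every state, so the deficit of edge [s.+1] makes the tail at [s] exceed the
   one at [s.+2], strictly in state 1. *)
have lt_W : W j s < W j s.+2.
  apply: (@propagate_lt 1%N) => //; try nat_lia.
    apply: W1lt => //; try nat_lia.
    rewrite -subr_gt0 T_diff //; last nat_lia.
    rewrite (@big_cat_nat _ _ _ j) /=; try nat_lia.
    rewrite ltr_wpDl //.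
      by rewrite big_nat_cond; apply: sumr_ge0 => k hk; rewrite z_s ?subr0 //; nat_lia.
    rewrite big_ltn ?z_s ?subr0 //; try nat_lia.
    rewrite ltr_pwDl // big_nat_cond; apply: sumr_ge0 => k hk.
    by rewrite z_s ?subr0 //; nat_lia.
  by move=> k hk; apply: T_ge => //; [nat_lia|move=> i' hi'; apply: z_s; nat_lia].
by apply: le_lt_trans Wj0 _; apply: lt_le_trans Wj2.
Qed.

End Tightness.

(** * Balance between the two alternating sets *)

Section TwoPhases.
Variables (R : realType) (n : nat) (c v : R) (g f : nat -> R -> R) (phi : R -> R).
Hypotheses (mk : regular_market n c v g f) (sc : sale_curve phi).
Variables (A B : nat -> R) (b : R).
Hypothesis b_ge1 : 1 <= b.
Hypothesis hA : forall j, (1 <= j <= n.+1)%N -> 0 <= A j < 1.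
Hypothesis hB : forall j, (1 <= j <= n.+1)%N -> 0 <= B j < 1.
Hypothesis A_end : A n.+1 = 0.
Hypothesis B_end : B n.+1 = 0.
Hypothesis A_anti : forall j, (1 <= j <= n)%N -> A j.+1 <= A j.
Hypothesis B_anti : forall j, (1 <= j <= n)%N -> B j.+1 <= B j.
Local Notation V := (nodeval c v g f phi).
Hypothesis A_opt : forall j, (1 <= j <= n)%N -> b * V A j < V B j -> A j = A j.+1.
Hypothesis B_opt : forall j, (1 <= j <= n)%N -> V B j < b * V A j -> B j = B j.+1.

Let b_gt0 : 0 < b. Proof. exact: lt_le_trans b_ge1. Qed.
Let bV_gt0 : 0 < b^-1. Proof. by rewrite invr_gt0. Qed.
Let hA1 j : (1 <= j <= n.+1)%N -> 0 <= A j <= 1.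
Proof. by move=> /hA/andP[-> /ltW]. Qed.
Let hB1 j : (1 <= j <= n.+1)%N -> 0 <= B j <= 1.
Proof. by move=> /hB/andP[-> /ltW]. Qed.

Let phiA_gt0 j : (1 <= j <= n.+1)%N -> 0 < phi (A j).
Proof. by move=> /hA/andP[]; exact: (curve_gt0 sc). Qed.

Let valN j : (b * V A j < V B j) = (V A j < b^-1 * V B j).
Proof. by rewrite mulrC -ltr_pdivlMr // mulrC. Qed.
Let valNle j : (b * V A j <= V B j) = (V A j <= b^-1 * V B j).
Proof. by rewrite mulrC -ler_pdivlMr // mulrC. Qed.
Let phiN j : (b * phi (A j) < phi (B j)) = (phi (A j) < b^-1 * phi (B j)).
Proof. by rewrite mulrC -ltr_pdivlMr // mulrC. Qed.
Let phiNle j : (b * phi (A j) <= phi (B j)) = (phi (A j) <= b^-1 * phi (B j)).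
Proof. by rewrite mulrC -ler_pdivlMr // mulrC. Qed.

Let V1 T : V T 1 = (f 1%N v - c) * phi (T 1%N). Proof. by []. Qed.
Let v_gt0 : 0 < f 1%N v - c. Proof. by rewrite subr_gt0 (market_v mk). Qed.

Lemma odd_phase_best i : (1 <= i <= n)%N -> V B i <= b * V A i.
Proof.
move=> hi; rewrite leNgt; apply/negP => N_i.
have ex : exists k, (1 <= k <= n)%N && (b * V A k < V B k) by exists i; rewrite hi.
case: (ex_minnP ex) => {hi N_i}{}i /andP[hi N_i] min_i.
have phi_i : b * phi (A i) < phi (B i).
  rewrite ltNge; apply/negP => le_phi; move: N_i; apply/negP; rewrite -leNgt.
  case: i hi min_i le_phi => [//|[|i]] hi min_i le_phi.
    by rewrite !V1 mulrCA ler_pM2l.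
  apply: (nodeval_step mk sc) => //; try nat_lia.
  by rewrite leNgt; apply/negP => h; have := min_i i.+1; rewrite h andbT; nat_lia.
have gt_A : B i < A i.
  rewrite -(curve_ltP sc) ?hA1 ?hB1 //; try nat_lia.
  by apply: le_lt_trans phi_i; rewrite ler_peMl // ltW // phiA_gt0; nat_lia.
have A_const k : (i <= k <= n)%N -> (b * V A k < V B k) /\ A k = A i.
  elim: k => [|k IH] hk; first by nat_lia.
  have [e|ne] := eqVneq i k.+1; first by rewrite -e.
  have [|N_k A_k] := IH; first by nat_lia.
  have A_k1 : A k.+1 = A i by rewrite -A_k -A_opt //; nat_lia.
  split => //; rewrite valN.
  apply: (nodeval_step_ltl mk sc) => //; try nat_lia; first by rewrite -valN.
  rewrite -phiNle A_k1; apply: le_trans (ltW phi_i) _.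
  suff B_k1 : B k.+1 <= B i by rewrite (curve_leP sc) ?hB1 //; nat_lia.
  have : (i <= k.+1)%N by nat_lia.
  elim: {A_k1 N_k A_k IH ne} k hk => [|k IH] hk ik; first by have -> : i = 1%N by nat_lia.
  have [->//|ne] := eqVneq i k.+2.
  by apply: le_trans (B_anti _) (IH _ _); nat_lia.
have [N_n A_n] := A_const n ltac:(nat_lia).
have := A_opt (j := n) ltac:(nat_lia) N_n; rewrite A_end A_n => A_i0.
have /andP[B_ge0 _] := hB (j := i) ltac:(nat_lia).
by move: gt_A; rewrite A_i0 ltNge B_ge0.
Qed.

Lemma two_phase_balance k : (1 <= k <= n)%N ->
  phi (B k) <= b * phi (A k) /\ (0 < B k -> phi (B k) = b * phi (A k)).
Proof.
move=> hk.
have E_phi i : (1 <= i <= n)%N -> (forall l, (1 <= l <= i)%N -> V B l = b * V A l) ->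
    phi (B i) = b * phi (A i).
  case: i => [//|[|i]] hi E.
    by have := E 1%N isT; rewrite !V1 mulrCA => /(mulfI (lt0r_neq0 v_gt0)).
  have E1 := E i.+1 ltac:(nat_lia); have E2 := E i.+2 ltac:(nat_lia).
  apply/eqP; rewrite eq_le !leNgt; apply/andP; split; apply/negP => lt_phi.
    rewrite phiN in lt_phi.
    have : V A i.+2 < b^-1 * V B i.+2.
      apply: (nodeval_step_ltr mk sc) => //; try nat_lia.
      by rewrite -valNle E1.
    by rewrite -valN E2 ltxx.
  have : V B i.+2 < b * V A i.+2.
    by apply: (nodeval_step_ltr mk sc) => //; try nat_lia; rewrite E1.
  by rewrite E2 ltxx.
have [/existsP[i0 P_i0]|/existsPn noP] :=
    boolP [exists i : 'I_n.+1, (1 <= i)%N && (V B i < b * V A i)]; last first.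
  have E l : (1 <= l <= n)%N -> V B l = b * V A l.
    move=> hl; apply/eqP; rewrite eq_le odd_phase_best // leNgt; apply/negP => P_l.
    have l_n : (l < n.+1)%N by nat_lia.
    by have := noP (Ordinal l_n); rewrite /= P_l andbT; nat_lia.
  by rewrite E_phi // => l hl; apply: E; nat_lia.
have ex : exists i, (1 <= i <= n)%N && (V B i < b * V A i).
  by exists i0; case/andP: P_i0 => -> ->; rewrite -ltnS ltn_ord.
case: (ex_minnP ex) => i /andP[hi P_i] min_i.
have E l : (1 <= l < i)%N -> V B l = b * V A l.
  move=> hl; apply/eqP; rewrite eq_le odd_phase_best; last by nat_lia.
  by rewrite leNgt; apply/negP => P_l; have := min_i l; rewrite P_l andbT; nat_lia.
have phi_i : phi (B i) < b * phi (A i).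
  rewrite ltNge; apply/negP => le_phi; move: P_i; apply/negP; rewrite -leNgt.
  case: i hi min_i le_phi E => [//|[|i]] hi min_i le_phi E.
    by rewrite !V1 mulrCA ler_pM2l.
  rewrite valNle; apply: (nodeval_step mk sc) => //; try nat_lia.
    by rewrite -valNle E //; nat_lia.
  by rewrite -phiNle.
have A_le l : (i <= l <= n)%N -> A l <= A i.
  elim: l => [|l IH] hl; first by nat_lia.
  have [->//|ne] := eqVneq i l.+1.
  by apply: le_trans (A_anti _) (IH _); nat_lia.
have B_const l : (i <= l <= n)%N -> (V B l < b * V A l) /\ B l = B i.
  elim: l => [|l IH] hl; first by nat_lia.
  have [e|ne] := eqVneq i l.+1; first by rewrite -e.
  have [|P_l B_l] := IH; first by nat_lia.
  have B_l1 : B l.+1 = B i by rewrite -B_l -B_opt //; nat_lia.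
  split => //; apply: (nodeval_step_ltl mk sc) => //; try nat_lia.
  rewrite B_l1; apply: le_trans (ltW phi_i) _; rewrite ler_pM2l //.
  by rewrite (curve_leP sc) ?hA1 ?A_le //; nat_lia.
have [P_n B_n] := B_const n ltac:(nat_lia).
have := B_opt (j := n) ltac:(nat_lia) P_n; rewrite B_end B_n => B_i0.
have [ki|ik] := ltnP k i; first by rewrite E_phi // => l hl; apply: E; nat_lia.
have [_ B_k] := B_const k ltac:(nat_lia).
rewrite B_k B_i0 ltxx; split => //; rewrite -B_i0.
apply: le_trans (ltW phi_i) _; rewrite ler_pM2l //.
by rewrite (curve_leP sc) ?hA1 ?A_le //; nat_lia.
Qed.

End TwoPhases.

(** * Balanced splits of a total mass *)

Section BalancedSplit.
Variables (R : realType) (phi : R -> R) (b : R).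
Hypotheses (sc : sale_curve phi) (b_ge1 : 1 <= b).

(** A complementarity condition: the even set may carry mass only where the scaled sale
    probabilities agree. *)
Definition balanced (A B : R) : Prop :=
  [/\ 0 <= A, 0 <= B, A + B < 1, phi B <= b * phi A & (0 < B -> phi B = b * phi A)].

(** If one part grew while the total did not, the other would shrink, and both changes would push
    the two sale probabilities out of balance in the same direction. Besides uniqueness, this yields
    the nonnegative masses of the existence proof. *)
Lemma balanced_le A B A' B' : balanced A B -> balanced A' B' -> A' + B' <= A + B ->
  A' <= A /\ B' <= B.
Proof.
move=> [A0 B0 AB bal eq_bal] [A'0 B'0 AB' bal' eq_bal'] le_sum.
have b_gt0 : 0 < b by exact: lt_le_trans b_ge1.
split; rewrite leNgt; apply/negP => lt.
  have BB' : B' < B by lra.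
  have phiB : phi B < phi B' by apply: (curve_decr sc) => //; lra.
  have phiA : phi A' < phi A by apply: (curve_decr sc) => //; lra.
  have : b * phi A' < b * phi A by rewrite ltr_pM2l.
  by rewrite -eq_bal; [lra|lra].
have AA' : A' < A by lra.
have phiB : phi B' < phi B by apply: (curve_decr sc) => //; lra.
have phiA : phi A < phi A' by apply: (curve_decr sc) => //; lra.
have : b * phi A < b * phi A' by rewrite ltr_pM2l.
by rewrite -eq_bal'; [lra|lra].
Qed.

Lemma balanced_uniq A B A' B' : balanced A B -> balanced A' B' -> A + B = A' + B' ->
  A = A' /\ B = B'.
Proof.
move=> bal bal' e.
have [h1 h2] : A' <= A /\ B' <= B by apply: balanced_le => //; rewrite e.
have [h3 h4] : A <= A' /\ B <= B' by apply: balanced_le => //; rewrite e.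
by split; lra.
Qed.

Lemma balanced_exists Q : 0 <= Q < 1 -> exists A, balanced A (Q - A).
Proof.
move=> /andP[Q0 Q1]; have b_gt0 : 0 < b by exact: lt_le_trans b_ge1.
(* In the first case the even set is not worth using even when it is empty, and all mass goes to the
   odd set. *)
have [le_Q|lt_Q] := leP (phi 0) (b * phi Q).
  by exists Q; rewrite subrr; split => //; lra.
(* Otherwise a zero of [h] is wanted: [h 0 >= 0] because [phi Q <= phi 0 = 1 <= b], and [h Q <= 0]
   is the present case. *)
pose h A := b * phi A - phi (Q - A).
have cont_h : continuous h.
  move=> x; apply: cvgB.
    by apply: cvgM; [exact: cvg_cst|exact: (curve_cont sc)].
  apply: (@continuous_comp _ _ _ (fun A => Q - A) phi); last exact: (curve_cont sc).
  by apply: cvgB; [exact: cvg_cst|exact: cvg_id].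
have h0 : 0 <= h 0.
  rewrite /h subr0 subr_ge0; apply: (@le_trans _ _ (phi 0)).
    by apply: (curve_anti sc) => //; lra.
  by rewrite ler_peMl // (curve0 sc).
have hQ : h Q <= 0 by rewrite /h subrr; lra.
have [A A_in hA] : exists2 A, A \in `[0, Q] & h A = 0.
  apply: IVT => //; first exact: continuous_subspaceT.
  by rewrite ge_min hQ orbT /= le_max h0.
exists A; move: A_in; rewrite in_itv /= => /andP[A0 AQ].
have e : phi (Q - A) = b * phi A by apply/esym/subr0_eq.
by split => //; [lra|lra|rewrite e].
Qed.

End BalancedSplit.

(** * Probability preliminaries *)

Local Open Scope classical_set_scope.

Section ProbabilityIntegral.
Context (d : measure_display) (T : measurableType d) (R : realType).
Variables (P : probability T R) (u : T -> R) (V : R).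
Hypotheses (mu : measurable_fun setT u) (V_ge0 : 0 <= V) (u_le : forall x, u x <= V).

Let meu : measurable_fun setT (EFin \o u).
Proof. exact/measurable_EFinP. Qed.

Lemma measurable_below : measurable [set x | u x < V].
Proof.
have -> : [set x | u x < V] = setT `&` [set x | ((EFin \o u) x < V%:E)%E].
  by rewrite setTI; apply/seteqP; split => x /=; rewrite lte_fin.
exact: emeasurable_fun_infty_o.
Qed.

Lemma integral_cst_prob : (\int[P]_x (cst V%:E x) = V%:E)%E.
Proof. by rewrite integral_cst //= probability_setT mule1. Qed.

Let pos_le : (\int[P]_x ((EFin \o u)^\+ x) <= V%:E)%E.
Proof.
rewrite -integral_cst_prob; apply: ge0_le_integral => //.
  exact: measurable_funepos.
by move=> x _ /=; rewrite funeposE /= ge_max !lee_fin u_le V_ge0.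
Qed.

Lemma integral_prob_le : (\int[P]_x (u x)%:E <= V%:E)%E.
Proof.
rewrite integralE; apply: le_trans pos_le.
by rewrite -[leRHS]sube0; apply: leeB => //; apply: integral_ge0.
Qed.

(** [u] is bounded above only, so integrability has to be derived: the positive part is bounded by
    [V], and the negative part is finite because the integral is. Then [V - u] is nonnegative with
    integral 0. *)
Lemma integral_prob_eq_null : (\int[P]_x (u x)%:E = V%:E)%E ->
  P [set x | u x < V] = 0%E.
Proof.
move=> eqV.
have int_u : P.-integrable setT (EFin \o u).
  have pos_fin : (\int[P]_x ((EFin \o u)^\+ x))%E \is a fin_num.
    rewrite ge0_fin_numE; first by apply: le_lt_trans pos_le _; rewrite ltry.
    by apply: integral_ge0.
  have neg_fin : (\int[P]_x ((EFin \o u)^\- x))%E \is a fin_num.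
    move: eqV; rewrite integralE; move: pos_fin.
    case: (\int[P]_x ((EFin \o u)^\+ x))%E => // r _.
    by case: (\int[P]_x ((EFin \o u)^\- x))%E.
  apply/integrableP; split=> //.
  under eq_integral do rewrite -/((abse \o (EFin \o u)) _) fune_abse.
  rewrite ge0_integralD //.
  - rewrite -ge0_fin_numE; first by rewrite fin_numD pos_fin.
    by apply: adde_ge0; exact: integral_ge0.
  - exact: measurable_funepos.
  - exact: measurable_funeneg.
have int_V : P.-integrable setT (cst V%:E).
  exact: finite_measure_integrable_cst.
have : (\int[P]_x (cst V%:E x - (u x)%:E) = 0)%E.
  rewrite (integralB measurableT int_V int_u) integral_cst_prob eqV.
  by rewrite subee.
rewrite (eq_integral (fun x => `|(V - u x)%:E|)%E); last first.
  by move=> x _ /=; rewrite ger0_norm // subr_ge0.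
move/ae_eq_integral_abs => /(_ measurableT) ae0.
have mVu : measurable_fun setT (fun x => V - u x).
  by apply: measurable_funB => //; exact: measurable_cst.
have [|N [mN N0 sub]] := ae0; first exact/measurable_EFinP.
apply: (subset_measure0 _ mN _ N0).
  exact: measurable_below.
move=> x /= ux; apply: sub => /= /(_ I) [] /eqP.
by rewrite subr_eq0 gt_eqF.
Qed.

Lemma integral_prob_null_eq : P [set x | u x < V] = 0%E ->
  (\int[P]_x (u x)%:E = V%:E)%E.
Proof.
move=> null; rewrite -integral_cst_prob; apply: ae_eq_integral => //.
exists [set x | u x < V]; split => //.
  exact: measurable_below.
move=> x /= ne; rewrite lt_neqAle u_le andbT; apply/eqP => e.
by apply: ne => _; rewrite e.
Qed.

End ProbabilityIntegral.

(** An average that reaches the average of the upper bounds attains every bound of positive weight.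
    The terms [x i] are extended reals because an expected payoff may be [-oo]: margins are
    unbounded below. *)
Lemma weighted_sum_eq (R : realType) (T : finType) (P : pred T) (w y : T -> R) (x : T -> \bar R) :
  (forall i, P i -> 0 <= w i) -> (forall i, P i -> w i != 0 -> (x i <= (y i)%:E)%E) ->
  ((\sum_(i | P i) w i * y i)%:E <= \sum_(i | P i) (w i)%:E * x i)%E ->
  forall i, P i -> 0 < w i -> x i = (y i)%:E.
Proof.
move=> w_ge0 x_le le_sum i Pi wi; apply/eqP; rewrite eq_le x_le ?gt_eqF //=.
rewrite leNgt; apply/negP => lt_xi; move: le_sum; apply/negP; rewrite -ltNge.
rewrite (bigD1 i) //= [X in (_ < X%:E)%E](bigD1 i) //= EFinD.
have lt_i : ((w i)%:E * x i < (w i * y i)%:E)%E by rewrite EFinM lte_pmul2l.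
have le_rest : (\sum_(k | P k && (k != i)) (w k)%:E * x k <=
    (\sum_(k | P k && (k != i)) w k * y k)%:E)%E.
  rewrite -sumEFin; apply: lee_sum => k /andP[Pk _]; rewrite EFinM.
  have [->|wk] := eqVneq (w k) 0; first by rewrite !mul0e.
  by apply: lee_wpmul2l; [rewrite lee_fin w_ge0|exact: x_le].
move: lt_i le_rest.
case: ((w i)%:E * x i)%E => [a||] //; case: (\sum_(k | P k && (k != i)) (w k)%:E * x k)%E => [b||] //=.
- by rewrite !lte_fin !lee_fin => *; exact: ltr_leD.
- by move=> _ _; rewrite ltNyr.
- by move=> _ _; rewrite ltNyr.
- by move=> _ _; rewrite ltNyr.
Qed.

(** * Distribution functions of penalty laws *)

Section LowerRays.
Variables (R : realType) (P : probability R R).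

Definition below (x : R) : R := fine (P [set y | y < x]).

Lemma measurable_ray (x : R) : measurable [set y : R | y < x].
Proof.
have -> : [set y : R | y < x] = `]-oo, x[%classic.
  by apply/seteqP; split => y /=; rewrite in_itv.
exact: measurable_itv.
Qed.

Lemma measurable_ball (x d : R) : measurable [set y : R | `|y - x| < d].
Proof.
have -> : [set y : R | `|y - x| < d] = `]x - d, x + d[%classic.
  apply/seteqP; split => y /=; rewrite in_itv /= ltr_norml => /andP[? ?];
  by apply/andP; split; lra.
exact: measurable_itv.
Qed.

Lemma fine_prob_le (A B : set R) : measurable A -> measurable B -> A `<=` B ->
  fine (P A) <= fine (P B).
Proof.
move=> mA mB AB; rewrite fine_le ?fin_num_measure //.
by apply: le_measure => //; rewrite inE.
Qed.

Lemma fine_prob_ge0 (A : set R) : 0 <= fine (P A).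
Proof. by rewrite fine_ge0. Qed.

Lemma fine_prob_le1 (A : set R) : measurable A -> fine (P A) <= 1.
Proof.
by move=> mA; rewrite -[leRHS]/(fine 1%:E) fine_le ?fin_num_measure // probability_le1.
Qed.

Lemma fine_probU (A B : set R) : measurable A -> measurable B -> A `&` B `<=` set0 ->
  fine (P (A `|` B)) = fine (P A) + fine (P B).
Proof.
by move=> mA mB; rewrite subset0 => AB; rewrite measureU // fineD ?fin_num_measure.
Qed.

Lemma below_le x y : x <= y -> below x <= below y.
Proof.
move=> xy; apply: fine_prob_le; try exact: measurable_ray.
by move=> z /= /lt_le_trans; apply.
Qed.

Lemma below_ge0 x : 0 <= below x. Proof. exact: fine_prob_ge0. Qed.
Lemma below_le1 x : below x <= 1.
Proof. by apply: fine_prob_le1; exact: measurable_ray. Qed.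

Lemma below_atom x y : x < y -> below x + fine (P [set x]) <= below y.
Proof.
move=> xy; rewrite -fine_probU //; last 2 first.
- exact: measurable_ray.
- by move=> z /= [] /[swap] ->; rewrite ltxx.
apply: fine_prob_le; [|exact: measurable_ray|].
  by apply: measurableU => //; exact: measurable_ray.
by move=> z /= [/lt_trans->//|->].
Qed.

Lemma below_atom_le1 x : below x + fine (P [set x]) <= 1.
Proof.
apply: le_trans (below_atom (_ : x < x + 1)) (below_le1 _).
by rewrite ltrDl.
Qed.

Lemma below_null x y : x <= y -> P [set z | x <= z < y] = 0%E -> below x = below y.
Proof.
move=> xy null; rewrite /below.
have -> : [set z | z < y] = [set z | z < x] `|` [set z | x <= z < y].
  apply/seteqP; split => z /=; first by case: (leP x z) => //= *; [right|left].
  by case=> [/lt_le_trans->//|/andP[]].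
have mxy : measurable [set z : R | x <= z < y].
  have -> : [set z | x <= z < y] = `[x, y[%classic by apply/seteqP; split => z /=; rewrite in_itv.
  exact: measurable_itv.
rewrite fine_probU ?null ?addr0 //; first exact: measurable_ray.
by move=> z /= [zx /andP[]]; rewrite leNgt zx.
Qed.

Lemma below_eq1 x : P [set z | x <= z] = 0%E -> below x = 1.
Proof.
move=> null; rewrite /below.
have -> : [set z | z < x] = ~` [set z | x <= z].
  by apply/seteqP; split => z /=; rewrite ltNge => /negP.
have mx : measurable [set z : R | x <= z].
  have -> : [set z | x <= z] = `[x, +oo[%classic.
    by apply/seteqP; split => z /=; rewrite in_itv /= andbT.
  exact: measurable_itv.
by rewrite probability_setC // null sube0.
Qed.

(** Jumps are atoms: the balls around [x] shrink to the null set [[set x]], so their probability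
    tends to 0, and it bounds the increments near [x]. *)
Lemma below_continuous : (forall x, P [set x] = 0%E) -> continuous below.
Proof.
move=> atomless x; apply/cvgrPdist_lt => e e_gt0.
pose B (k : nat) := [set y : R | `|y - x| < k.+1%:R^-1].
have cvgB : P \o B @ \oo --> P (\bigcap_k B k).
  apply: nonincreasing_cvg_mu.
  - by apply: le_lt_trans (probability_le1 _ _) _; [exact: measurable_ball|rewrite ltry].
  - by move=> k; exact: measurable_ball.
  - by apply: bigcapT_measurable => k; exact: measurable_ball.
  - move=> i j ij; apply/subsetPset => y /= /lt_le_trans; apply.
    by rewrite lef_pV2 ?posrE ?ltr0n // ler_nat.
have capB : \bigcap_k B k = [set x].
  apply/seteqP; split => [y By|y -> k _]; last by rewrite /B /= subrr normr0 invr_gt0.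
  apply/eqP; rewrite -subr_eq0 -normr_le0; apply/ler_addgt0Pr => d d_gt0; rewrite add0r.
  have [k hk] : exists k : nat, k.+1%:R^-1 < d.
    exists (Num.truncn d^-1).
    by rewrite invf_plt ?posrE ?ltr0n //; exact: truncnS_gt.
  by apply/ltW/(lt_trans (By k I)).
rewrite capB atomless in cvgB.
have cvgB0 : fine \o (P \o B) @ \oo --> (0 : R) by exact: fine_cvg.
have [k _ hk] := cvgr_lt _ cvgB0 _ e_gt0.
have Bk : fine (P (B k)) < e by apply: hk => /=.
exists k.+1%:R^-1 => /= [|y]; first by rewrite invr_gt0.
rewrite /= distrC => xy; apply: le_lt_trans Bk.
have diff a b : a <= b -> (forall z, a <= z < b -> B k z) -> `|below b - below a| <= fine (P (B k)).
  move=> ab sub; rewrite ger0_norm ?subr_ge0 ?below_le // lerBlDl /below.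
  have -> : [set z | z < b] = [set z | z < a] `|` [set z | a <= z < b].
    apply/seteqP; split => z /=; first by case: (leP a z) => //= *; [right|left].
    by case=> [/lt_le_trans->//|/andP[]].
  have mab : measurable [set z : R | a <= z < b].
    have -> : [set z | a <= z < b] = `[a, b[%classic by apply/seteqP; split => z /=; rewrite in_itv.
    exact: measurable_itv.
  rewrite fine_probU //; last by move=> z /= [zx /andP[]]; rewrite leNgt zx.
    by rewrite lerD2l; apply: fine_prob_le => //; exact: measurable_ball.
  exact: measurable_ray.
have [xy'|yx] := leP x y.
  rewrite distrC; apply: diff => // z /andP[xz zy].
  rewrite /B /= ger0_norm ?subr_ge0 //; apply: le_lt_trans xy.
  by rewrite ger0_norm ?subr_ge0 // lerD2r ltW.
apply: diff; first exact: ltW.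
move=> z /andP[yz zx]; rewrite /B /= distrC gtr0_norm ?subr_gt0 //; apply: le_lt_trans xy.
by rewrite distrC gtr0_norm ?subr_gt0 // lerD2l lerN2.
Qed.

End LowerRays.

(** * Equilibrium at a single node *)

Section Tails.
Variables (R : realType) (n : nat) (r : nat -> R).
Hypothesis r_ge0 : forall j, (1 <= j <= n)%N -> 0 <= r j.

Definition tail (j : nat) : R := \sum_(j <= i < n.+1) r i.

Lemma tail_end : tail n.+1 = 0. Proof. by rewrite /tail big_geq. Qed.

Lemma tailS j : (1 <= j <= n)%N -> tail j = r j + tail j.+1.
Proof. by move=> hj; rewrite /tail big_ltn //; nat_lia. Qed.

Lemma tail_ge0 j : (1 <= j)%N -> 0 <= tail j.
Proof. by move=> hj; rewrite /tail big_nat_cond; apply: sumr_ge0 => i hi; apply: r_ge0; nat_lia. Qed.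

Lemma tail_le1 j : (1 <= j <= n.+1)%N -> tail j <= tail 1%N.
Proof.
elim: j => // j IH hj; have [->//|j0] := eqVneq j 0%N.
have e := @tailS j ltac:(nat_lia); have := r_ge0 (j := j) ltac:(nat_lia); have := IH ltac:(nat_lia); lra.
Qed.

Lemma tail_lt1 : tail 1%N < 1 -> forall j, (1 <= j <= n.+1)%N -> 0 <= tail j < 1.
Proof.
move=> r1 j hj; rewrite tail_ge0 /=; last by nat_lia.
by apply: le_lt_trans r1; exact: tail_le1.
Qed.

End Tails.

Section NodeEquilibrium.
Variables (R : realType) (n : nat) (c v : R) (g f : nat -> R -> R) (phi : R -> R).
Hypotheses (n_gt0 : (1 <= n)%N) (mk : regular_market n c v g f) (sc : sale_curve phi).
Variables (r : nat -> R) (mu : nat -> probability R R) (tie : R -> R -> R) (V : nat -> R).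
Hypothesis r_ge0 : forall j, (1 <= j <= n)%N -> 0 <= r j.
Local Notation T := (tail n r).
Hypothesis r_sum : T 1%N < 1.
Hypothesis tie0 : forall p, tie p 0 = phi p.
Hypothesis tie_ge : forall p0 p1, 0 <= p0 -> 0 <= p1 -> p0 + p1 <= 1 -> phi (p0 + p1) <= tie p0 p1.
Hypothesis tie_lt : forall p0 p1, 0 <= p0 -> 0 < p1 -> p0 + p1 <= 1 -> tie p0 p1 < phi p0.

Definition lt_mass (x : R) : R := \sum_(1 <= j < n.+1) r j * below (mu j) x.
Definition at_mass (x : R) : R := \sum_(1 <= j < n.+1) r j * fine (mu j [set x]).
Local Notation F := lt_mass.
Local Notation E := at_mass.

Definition offer_value (j : nat) (x : R) : R :=
  if x <= v then (f j x - c) * tie (F x) (E x) else 0.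
Local Notation u := offer_value.

(** The equilibrium conditions at one node: [V j] is the supremum of the offer values, and a used
    state puts no mass on penalties that fall short of it. That the supremum is attained is derived
    below, from continuity in the absence of atoms. *)
Hypothesis V_ub : forall j x, (1 <= j <= n)%N -> u j x <= V j.
Hypothesis V_sup : forall j e, (1 <= j <= n)%N -> 0 < e -> exists x, V j - e < u j x.
Hypothesis V_supp : forall j (A : set R), (1 <= j <= n)%N -> 0 < r j -> measurable A ->
  (forall x, A x -> u j x < V j) -> mu j A = 0%E.

Let hT j : (1 <= j <= n.+1)%N -> 0 <= T j < 1.
Proof. exact: tail_lt1. Qed.
Local Notation B := (brk c v g f phi T).

Let sum_ge0 (h : nat -> R) : (forall j, (1 <= j <= n)%N -> 0 <= h j) ->
  0 <= \sum_(1 <= j < n.+1) h j.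
Proof. by move=> hh; rewrite big_nat_cond; apply: sumr_ge0 => i hi; apply: hh; nat_lia. Qed.

Let sum_le (h h' : nat -> R) : (forall j, (1 <= j <= n)%N -> h j <= h' j) ->
  \sum_(1 <= j < n.+1) h j <= \sum_(1 <= j < n.+1) h' j.
Proof. by move=> hh; apply: ler_sum_nat => j hj; apply: hh; nat_lia. Qed.

Let F_ge0 x : 0 <= F x.
Proof. by apply: sum_ge0 => j hj; rewrite mulr_ge0 ?r_ge0 ?below_ge0. Qed.

Let E_ge0 x : 0 <= E x.
Proof. by apply: sum_ge0 => j hj; rewrite mulr_ge0 ?r_ge0 ?fine_prob_ge0. Qed.

Let FE_le1 x : F x + E x <= T 1%N.
Proof.
rewrite -big_split /=; apply: sum_le => j hj; rewrite -mulrDr.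
by rewrite ler_piMr ?r_ge0 ?below_atom_le1.
Qed.

Let FE_1 x : F x + E x <= 1.
Proof. exact: le_trans (FE_le1 x) (ltW r_sum). Qed.

Let F_le1 x : F x <= T 1%N. Proof. by have := FE_le1 x; have := E_ge0 x; lra. Qed.

Let FE_le x y : x < y -> F x + E x <= F y.
Proof.
move=> xy; rewrite -big_split /=; apply: sum_le => j hj; rewrite -mulrDr.
by rewrite ler_wpM2l ?r_ge0 ?below_atom.
Qed.

Let f1n j : (1 <= j <= n)%N -> c < f j v.
Proof.
move=> hj; have cv := market_v mk; have [->//|j1] := eqVneq j 1%N.
by apply: lt_trans cv _; apply: (f_state mk) => //; nat_lia.
Qed.

Let phi_pos p : 0 <= p -> p <= T 1%N -> 0 < phi p.
Proof. by move=> p0 pT; apply: (curve_gt0 sc) => //; exact: le_lt_trans r_sum. Qed.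

Let V_gt0 j : (1 <= j <= n)%N -> 0 < V j.
Proof.
move=> hj; apply: lt_le_trans (V_ub v hj); rewrite /u lexx mulr_gt0 ?subr_gt0 ?f1n //.
have FE0 := F_ge0 v; have E0 := E_ge0 v; have FE1 := FE_le1 v.
have FE1' := FE_1 v.
apply: lt_le_trans (tie_ge FE0 E0 FE1').
by apply: phi_pos => //; lra.
Qed.

(* Undercutting a tie by an arbitrarily small amount gains a positive share. *)
Let no_atom x : E x = 0.
Proof.
apply/eqP; rewrite eq_le E_ge0 andbT leNgt; apply/negP => E_gt0.
have [j hj rm] : exists2 j, (1 <= j <= n)%N & 0 < r j * fine (mu j [set x]).
  apply: contrapT => no; suff E0 : E x <= 0 by rewrite ltNge E0 in E_gt0.
  rewrite /E big_nat_cond; apply: sumr_le0 => j hj; rewrite leNgt; apply/negP => h.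
  by apply: no; exists j => //; nat_lia.
have rj : 0 < r j.
  rewrite lt_neqAle r_ge0 // andbT; apply/eqP => r0; move: rm; by rewrite -r0 mul0r ltxx.
have uV : u j x = V j.
  apply/eqP; rewrite eq_le V_ub //= leNgt; apply/negP => lt_u.
  have := @V_supp j [set x] hj rj (measurable_set1 _).
  by move=> mu0; move: rm; rewrite mu0 ?mulr0 ?ltxx // => y ->.
have Vj := V_gt0 hj.
have x_v : x <= v.
  by rewrite leNgt; apply/negP => vx; move: uV Vj; rewrite /u leNgt vx /= => <-; rewrite ltxx.
have FE1 := FE_le1 x; have F0 := F_ge0 x.
have phiF : 0 < phi (F x) by apply: phi_pos => //; exact: F_le1.
have tie_x : tie (F x) (E x) < phi (F x) by apply: tie_lt => //; exact: FE_1.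
have uE : (f j x - c) * tie (F x) (E x) = V j by rewrite -uV /u x_v.
have tie_pos : 0 < tie (F x) (E x).
  have E0 := E_ge0 x; have FE1' := FE_1 x.
  by apply: lt_le_trans (tie_ge F0 E0 FE1'); apply: phi_pos; lra.
have fx : 0 < f j x - c by rewrite -(pmulr_lgt0 _ tie_pos) uE.
(* The margin at [z] is halfway between the margin at [x] and the smaller one that, sold with
   probability [phi (F x)], would earn what the tie earns. The penalty [y] of this margin undercuts
   [x] and earns more. *)
pose z := c + ((f j x - c) * tie (F x) (E x) / phi (F x) + (f j x - c)) / 2.
have lt1 : (f j x - c) * tie (F x) (E x) / phi (F x) < f j x - c.
  by rewrite ltr_pdivrMr // ltr_pM2l.
have z_lt : z < f j x by rewrite /z; lra.
have z_gt : (f j x - c) * tie (F x) (E x) / phi (F x) < z - c by rewrite /z; lra.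
pose y := g j z.
have y_lt : y < x by rewrite /y (g_lt mk).
have FEy := FE_le y_lt.
have : V j < u j y.
  rewrite /u (le_trans (ltW y_lt) x_v) /y (market_fg mk hj) -/y -uE.
  have zc : 0 < z - c by apply: le_lt_trans z_gt; rewrite divr_ge0 ?mulr_ge0 // ltW.
  rewrite ltr_pdivrMr // in z_gt; apply: lt_le_trans z_gt _; rewrite ler_pM2l //.
  have Fy := F_ge0 y; have Ey := E_ge0 y; have FE1' := FE_1 y.
  apply: le_trans (tie_ge Fy Ey FE1').
  apply: (curve_anti sc) => //; first exact: addr_ge0.
  by apply: le_trans (FE_1 x); rewrite lerDl.
by rewrite ltNge V_ub.
Qed.

Let uE j x : x <= v -> u j x = (f j x - c) * phi (F x).
Proof. by rewrite /u => ->; rewrite no_atom tie0. Qed.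

Let atom0 j x : (1 <= j <= n)%N -> 0 < r j -> mu j [set x] = 0%E.
Proof.
move=> hj rj; have : r j * fine (mu j [set x]) <= E x.
  rewrite /E (bigD1_seq j) ?iota_uniq ?mem_index_iota //=.
  rewrite lerDl big_seq_cond; apply: sumr_ge0 => i; rewrite mem_index_iota => hi.
  by rewrite mulr_ge0 ?fine_prob_ge0 // r_ge0 //; nat_lia.
rewrite no_atom pmulr_rle0 // => le0.
rewrite -[LHS]fineK ?fin_num_measure //.
by congr (_%:E); apply/eqP; rewrite eq_le le0 fine_prob_ge0.
Qed.

Let F_cont : continuous F.
Proof.
rewrite (_ : F = fun x => \sum_(1 <= j < n.+1 | (1 <= j < n.+1)%N && true) r j * below (mu j) x);
  last by apply/funext => x; rewrite /lt_mass big_nat_cond.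
apply: continuous_big => [|j hj]; first exact: add_continuous.
have hj' : (1 <= j <= n)%N by nat_lia.
have [rj|rj|rj] := ltgtP 0 (r j).
- move=> x; apply: cvgM; first exact: cvg_cst.
  by apply: below_continuous => y; exact: atom0.
- by have := r_ge0 hj'; rewrite leNgt rj.
- rewrite -rj (_ : (fun _ => _) = fun=> 0); first by move=> x; exact: cvg_cst.
  by apply/funext => x; rewrite mul0r.
Qed.

Let f_cont j : (1 <= j <= n)%N -> continuous (f j).
Proof.
move=> hj x; apply/cvgrPdist_lt => e e_gt0.
have lo : g j (f j x - e) < x by rewrite (g_lt mk) // ltrBlDr ltrDl.
have hi : x < g j (f j x + e) by rewrite -(f_incr mk hj) (market_fg mk) // ltrDl.
near=> y; have yx : `|x - y| < Num.min (x - g j (f j x - e)) (g j (f j x + e) - x).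
  near: y; apply: cvgr_dist_lt; first exact: cvg_id.
  by rewrite lt_min !subr_gt0 lo hi.
move: yx; rewrite lt_min => /andP[]; rewrite !ltr_norml => /andP[h1 h2] /andP[h3 h4].
have h5 : f j x - e < f j y by rewrite -(g_lt mk) //; lra.
have h6 : f j y < f j x + e by rewrite -[ltRHS](market_fg mk hj) (f_incr mk hj); lra.
by apply/andP; split; lra.
Unshelve. all: by end_near. Qed.

Let opt j x := x <= v /\ (f j x - c) * phi (F x) = V j.

Let phiF x : 0 < phi (F x). Proof. exact: phi_pos. Qed.

Let opt_pos j x : (1 <= j <= n)%N -> opt j x -> c < f j x.
Proof. by move=> hj [_ e]; rewrite -subr_gt0 -(pmulr_lgt0 _ (phiF x)) e V_gt0. Qed.

Let val_le j x : (1 <= j <= n)%N -> x <= v -> (f j x - c) * phi (F x) <= V j.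
Proof. by move=> hj xv; rewrite -uE ?V_ub. Qed.

Let val_cont j : (1 <= j <= n)%N -> continuous (fun x => (f j x - c) * phi (F x)).
Proof.
move=> hj x; apply: cvgM.
  by apply: cvgB; [exact: f_cont|exact: cvg_cst].
by apply: (@continuous_comp _ _ _ F phi); [exact: F_cont|exact: (curve_cont sc)].
Qed.

Let gc_lt j x : (1 <= j <= n)%N -> opt j x -> g j c < x.
Proof. by move=> hj ox; rewrite (g_lt mk) // opt_pos. Qed.

(** The continuous value has a maximum on the compact interval from [g j c] to [v]; outside it an
    offer earns at most 0. *)
Let opt_ex j : (1 <= j <= n)%N -> exists x, opt j x.
Proof.
move=> hj; have gv : g j c <= v by rewrite ltW // (g_lt mk) // f1n.
have [x /[!in_itv]/= /andP[gx xv] max_x] :=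
  EVT_max gv (continuous_subspaceT (@val_cont j hj)).
exists x; split => //; apply/eqP; rewrite eq_le val_le //= leNgt; apply/negP => ltV.
have xpos : 0 <= (f j x - c) * phi (F x).
  by rewrite mulr_ge0 ?(ltW (phiF x)) // subr_ge0 -[leLHS](market_fg mk hj) (f_incr_le mk hj).
have [|y] := V_sup hj (_ : 0 < V j - (f j x - c) * phi (F x)); first by rewrite subr_gt0.
rewrite subKr; have [yv|yv] := leP y v; last by rewrite /u leNgt yv /= ltNge xpos.
rewrite uE //; apply/negP; rewrite -leNgt.
have [gy|yg] := leP (g j c) y; first by apply: max_x; rewrite in_itv /= gy.
apply: le_trans xpos; rewrite mulr_le0_ge0 ?(ltW (phiF y)) // subr_le0.
by rewrite -[leRHS](market_fg mk hj) (f_incr_le mk hj) ltW.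
Qed.

(* Single crossing: a lower state gains relatively more from a higher penalty. *)
Let opt_order i j x y : (1 <= i)%N -> (i < j)%N -> (j <= n)%N ->
  opt i x -> opt j y -> y <= x.
Proof.
move=> i1 ij jn ox oy; rewrite leNgt; apply/negP => xy.
have hi : (1 <= i <= n)%N by nat_lia.
have hj : (1 <= j <= n)%N by nat_lia.
have cx := opt_pos hi ox; have cy := opt_pos hj oy.
have := margin_ratio mk i1 ij jn cx xy.
have := val_le hi oy.1; rewrite -ox.2 => le_i.
have := val_le hj ox.1; rewrite -oy.2 => le_j.
have ciy : 0 < f i y - c by rewrite subr_gt0 (lt_trans cx) // (f_incr mk hi).
apply/negP; rewrite -leNgt -(ler_pM2r (mulr_gt0 (phiF x) (phiF y))).
rewrite [X in X <= _](_ : _ = ((f i y - c) * phi (F y)) * ((f j x - c) * phi (F x))); last by ring.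
rewrite [X in _ <= X](_ : _ = ((f i x - c) * phi (F x)) * ((f j y - c) * phi (F y))); last by ring.
have cjx : 0 < f j x - c by rewrite subr_gt0 (lt_trans cx) // (f_state mk).
by apply: ler_pM => //; rewrite ltW // mulr_gt0.
Qed.

Let null j (A : set R) : (1 <= j <= n)%N -> 0 < r j -> measurable A ->
  (forall x, A x -> ~ opt j x) -> mu j A = 0%E.
Proof.
move=> hj rj mA sub; apply: V_supp => // x /sub nopt.
rewrite lt_neqAle V_ub // andbT; apply/eqP => e; apply: nopt.
have [xv|vx] := leP x v; first by split; rewrite // -uE.
by have := V_gt0 hj; rewrite -e /u leNgt vx ltxx.
Qed.

Let null_co j x y : (1 <= j <= n)%N -> 0 < r j -> (forall z, x < z < y -> ~ opt j z) ->
  mu j [set z | x <= z < y] = 0%E.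
Proof.
move=> hj rj no; have [yx|xy] := leP y x.
  rewrite (_ : mkset _ = set0) ?measure0 //; apply/seteqP; split => z //= /andP[xz].
  by rewrite ltNge (le_trans yx xz).
have mo : measurable [set z : R | x < z < y].
  have -> : [set z | x < z < y] = `]x, y[%classic by apply/seteqP; split => z /=; rewrite in_itv.
  exact: measurable_itv.
rewrite (_ : mkset _ = [set x] `|` [set z | x < z < y]); last first.
  apply/seteqP; split => z /=; last by move=> [->|/andP[/ltW-> ->//]]; rewrite lexx.
  by rewrite le_eqVlt => /andP[/predU1P[->|xz] zy]; [left|right; rewrite xz].
rewrite measureU //; last by apply/seteqP; split => z //= [-> /andP[]]; rewrite ltxx.
by rewrite -[RHS]adde0; congr (_ + _)%E; [exact: atom0|exact: null].
Qed.

Let null_ge j x : (1 <= j <= n)%N -> 0 < r j -> (forall z, x < z -> ~ opt j z) ->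
  mu j [set z | x <= z] = 0%E.
Proof.
move=> hj rj no.
have mo : measurable [set z : R | x < z].
  have -> : [set z | x < z] = `]x, +oo[%classic.
    by apply/seteqP; split => z /=; rewrite in_itv /= andbT.
  exact: measurable_itv.
rewrite (_ : mkset _ = [set x] `|` [set z | x < z]); last first.
  apply/seteqP; split => z /=; last by move=> [->|/ltW].
  by rewrite le_eqVlt => /predU1P[->|xz]; [left|right].
rewrite measureU //; last by apply/seteqP; split => z //= [->]; rewrite ltxx.
by rewrite -[RHS]adde0; congr (_ + _)%E; [exact: atom0|exact: null].
Qed.

Let below0 j x : (1 <= j <= n)%N -> 0 < r j -> (forall y, y < x -> ~ opt j y) ->
  below (mu j) x = 0.
Proof.
by move=> hj rj no; rewrite /below null //; exact: measurable_ray.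
Qed.

Let F_split k x : (1 <= k <= n.+1)%N ->
  (forall i, (1 <= i < k)%N -> forall y, y < x -> ~ opt i y) ->
  (forall i, (k <= i <= n)%N -> forall y, x < y -> ~ opt i y) -> F x = T k.
Proof.
move=> hk lo hi; rewrite /F (@big_cat_nat _ _ _ k) /=; try nat_lia.
rewrite big_nat_cond big1 ?add0r.
  rewrite /tail; apply: eq_big_nat => i hi'.
  have hi'' : (1 <= i <= n)%N by nat_lia.
  have := r_ge0 hi''; rewrite le_eqVlt => /predU1P[<-|ri]; first by rewrite mul0r.
  by rewrite below_eq1 ?mulr1 //; apply: null_ge => // y; apply: hi; nat_lia.
move=> i hi'; have hi'' : (1 <= i <= n)%N by nat_lia.
have := r_ge0 hi''; rewrite le_eqVlt => /predU1P[<-|ri]; first by rewrite mul0r.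
by rewrite below0 ?mulr0 //; apply: lo; nat_lia.
Qed.

Let opt_compact j p p' : (1 <= j <= n)%N -> 
  compact [set x | p <= x <= p' /\ (f j x - c) * phi (F x) = V j].
Proof.
move=> hj; rewrite (_ : mkset _ = `[p, p'] `&`
   (fun x => (f j x - c) * phi (F x)) @^-1` [set V j]); last first.
  by apply/seteqP; split => x /=; rewrite in_itv.
apply: compact_closedI; first exact: segment_compact.
by have /continuous_closedP := val_cont hj; apply; exact: closed_eq.
Qed.

Let opt_max j p p' : (1 <= j <= n)%N -> p' <= v -> (exists x, opt j x /\ p <= x <= p') ->
  exists x, [/\ opt j x, p <= x <= p' & forall y, opt j y -> p <= y <= p' -> y <= x].
Proof.
move=> hj pv [x0 [[x0v ex0] px0]].
have ne : [set x | p <= x <= p' /\ (f j x - c) * phi (F x) = V j] !=set0 by exists x0.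
have [x] := compact_EVT_max ne (opt_compact (p := p) (p' := p') hj)
  (continuous_subspaceT (fun x => @cvg_id _ (nbhs x))).
rewrite inE /= => -[px ex] max_x; exists x; split => //.
  by split => //; case/andP: px => _ /le_trans; apply.
by move=> y [yv ey] py; apply: max_x; rewrite inE.
Qed.

Let opt_min j p p' : (1 <= j <= n)%N -> p' <= v -> (exists x, opt j x /\ p <= x <= p') ->
  exists x, [/\ opt j x, p <= x <= p' & forall y, opt j y -> p <= y <= p' -> x <= y].
Proof.
move=> hj pv [x0 [[x0v ex0] px0]].
have ne : [set x | p <= x <= p' /\ (f j x - c) * phi (F x) = V j] !=set0 by exists x0.
have cN : continuous (fun x : R => - x) by exact: opp_continuous.
have [x] := compact_EVT_max ne (opt_compact (p := p) (p' := p') hj) (continuous_subspaceT cN).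
rewrite inE /= => -[px ex] max_x; exists x; split => //.
  by split => //; case/andP: px => _ /le_trans; apply.
by move=> y [yv ey] py; rewrite -lerN2; apply: max_x; rewrite inE.
Qed.

(** By the ordering of best replies, the mass below the largest one [x1] of state [j] is the tail
    from [j], and below the smallest one [x2] it is the tail from [j.+1]. Since [t] has the same
    mass below it as [x1], a smaller [x1] would earn less than [t]; hence [x1 = t], and equal values
    at [x1] and [x2] give the equation of [brk]. *)
Let opt_brk_step j t : (1 <= j <= n)%N -> t <= v -> F t = T j -> B j.-1 = t ->
  (forall y, opt j y -> y <= t) ->
  [/\ opt j (B j.-1), opt j (B j), (forall y, opt j y -> B j <= y <= B j.-1),
      F (B j.-1) = T j & F (B j) = T j.+1].
Proof.
move=> hj tv Ft Bt opt_t.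
have [x0 ox0] := opt_ex hj.
have ex : exists x, opt j x /\ g j c <= x <= v.
  by exists x0; split => //; rewrite ltW ?gc_lt //; case: ox0.
have all_in y : opt j y -> g j c <= y <= v by move=> oy; rewrite ltW ?gc_lt //; case: oy.
have [x1 [ox1 _ max1]] := opt_max hj (lexx v) ex.
have [x2 [ox2 _ min2]] := opt_min hj (lexx v) ex.
have F1 : F x1 = T j.
  apply: F_split => [|i hi y yx oy|i hi y xy oy]; first nat_lia.
    by have := @opt_order i j y x1 ltac:(nat_lia) ltac:(nat_lia) ltac:(nat_lia) oy ox1; rewrite leNgt yx.
  have [e|ne] := eqVneq i j; first by rewrite e in oy; have := max1 y oy (all_in y oy); rewrite leNgt xy.
  by have := @opt_order j i x1 y ltac:(nat_lia) ltac:(nat_lia) ltac:(nat_lia) ox1 oy; rewrite leNgt xy.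
have F2 : F x2 = T j.+1.
  apply: F_split => [|i hi y yx oy|i hi y xy oy]; first nat_lia.
    have [e|ne] := eqVneq i j; first by rewrite e in oy; have := min2 y oy (all_in y oy); rewrite leNgt yx.
    by have := @opt_order i j y x2 ltac:(nat_lia) ltac:(nat_lia) ltac:(nat_lia) oy ox2; rewrite leNgt yx.
  by have := @opt_order j i x2 y ltac:(nat_lia) ltac:(nat_lia) ltac:(nat_lia) ox2 oy; rewrite leNgt xy.
have e1 : x1 = t.
  apply/eqP; rewrite eq_le opt_t //= leNgt; apply/negP => lt1.
  have := val_le hj tv; rewrite -ox1.2 Ft F1; apply/negP; rewrite -ltNge.
  by rewrite ltr_pM2r ?ltrD2r ?(f_incr mk hj) // -F1.
have V_val : V j = nodeval c v g f phi T j by rewrite -ox1.2 F1 e1 /nodeval Bt.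
have e2 : x2 = B j.
  have := ox2.2; rewrite V_val F2 -(nodevalE mk sc hT hj) => /mulIf.
  have phi2 : phi (T j.+1) != 0 by rewrite gt_eqF // -F2.
  by move=> /(_ phi2)/addIr/(congr1 (g j)); rewrite !(market_gf mk).
rewrite -e2 Bt -e1; split => //.
by move=> y oy; rewrite max1 ?min2 ?all_in.
Qed.

Let opt_brk j : (1 <= j <= n)%N ->
  [/\ opt j (B j.-1), opt j (B j), (forall y, opt j y -> B j <= y <= B j.-1),
      F (B j.-1) = T j & F (B j) = T j.+1].
Proof.
case: j => // j; elim: j => [|j IH] hj.
  apply: (opt_brk_step (t := v)) => //; last by move=> y [].
  by apply: F_split => // [i|i hi y vy [yv _]]; [nat_lia|rewrite leNgt vy in yv].
have [_ ob2 _ _ F2] := IH ltac:(nat_lia).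
apply: (opt_brk_step (t := B j.+1)) => //; first by case: ob2.
by move=> y; apply: (opt_order (i := j.+1)) => //; nat_lia.
Qed.

Lemma node_value j : (1 <= j <= n)%N -> V j = nodeval c v g f phi T j.
Proof. by move=> hj; have [ob1 _ _ F1 _] := opt_brk hj; rewrite -ob1.2 F1. Qed.

(** There are no gaps: if [y] and [z] are the best replies of state [j] next to [x] on either side,
    no state offers between them, so the sale probabilities at [y] and [z] agree, hence the margins,
    hence [y = z]. *)
Let opt_full j x : (1 <= j <= n)%N -> B j <= x <= B j.-1 -> opt j x.
Proof.
move=> hj /andP[Bx xB]; have [ob1 ob2 ob3 F1 F2] := opt_brk hj.
have Bv : B j.-1 <= v by case: ob1.
have [|y [oy /andP[By yx] max_y]] := @opt_max j (B j) x hj (le_trans xB Bv).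
  by exists (B j); rewrite lexx.
have [|z [oz /andP[xz zB] min_z]] := @opt_min j x (B j.-1) hj Bv.
  by exists (B j.-1); rewrite lexx andbT.
have yz : y <= z by exact: le_trans xz.
have Fyz : F y = F z.
  rewrite /F; apply: eq_big_nat => i hi; have hi' : (1 <= i <= n)%N by nat_lia.
  have := r_ge0 hi'; rewrite le_eqVlt => /predU1P[<-|ri]; first by rewrite !mul0r.
  congr (_ * _); apply: below_null => //; apply: null_co => // w /andP[yw wz] ow.
  have [ij|ji|ij] := ltngtP i j.
  - have := @opt_order i j w (B j.-1) ltac:(nat_lia) ij ltac:(nat_lia) ow ob1.
    by rewrite leNgt (lt_le_trans wz zB).
  - have := @opt_order j i (B j) w ltac:(nat_lia) ji ltac:(nat_lia) ob2 ow.
    by rewrite leNgt (le_lt_trans By yw).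
  - rewrite ij in ow; have [wx|xw] := leP w x.
      by have := max_y w ow; rewrite wx (ltW (le_lt_trans By yw)) leNgt yw => /(_ isT).
    by have := min_z w ow; rewrite (ltW xw) (ltW (lt_le_trans wz zB)) leNgt wz => /(_ isT).
have /(congr1 (g j)) : f j y = f j z.
  have := oy.2; rewrite -oz.2 Fyz => /mulIf; rewrite gt_eqF // => /(_ isT).
  exact: addIr.
rewrite !(market_gf mk) // => yz'.
by have -> : x = y by apply/eqP; rewrite eq_le yx yz' xz.
Qed.

(** Since every penalty of the interval is a best reply, indifference prescribes [phi] of the mass
    below each of them. *)
Lemma node_cdf j x : (1 <= j <= n)%N -> 0 < r j ->
  [/\ x <= B j -> below (mu j) x = 0, B j.-1 <= x -> below (mu j) x = 1 &
      B j <= x <= B j.-1 ->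
        (f j x - c) * phi (T j.+1 + r j * below (mu j) x) = nodeval c v g f phi T j].
Proof.
move=> hj rj; have [ob1 ob2 ob3 F1 F2] := opt_brk hj; split.
- move=> xB; apply: below0 => // y yx oy; have /andP[By _] := ob3 y oy.
  by move: (lt_le_trans yx xB); rewrite ltNge By.
- move=> Bx; apply: below_eq1; apply: null_ge => // y xy oy; have /andP[_ yB] := ob3 y oy.
  by move: (le_lt_trans Bx xy); rewrite ltNge yB.
- move=> /[dup] Bx /andP[Bx1 Bx2]; rewrite -node_value // -(opt_full hj Bx).2; congr (_ * phi _).
  rewrite /lt_mass (@big_cat_nat _ _ _ j) /=; try nat_lia.
  rewrite big_nat_cond big1 ?add0r; last first.
    move=> i hi; have hi' : (1 <= i <= n)%N by nat_lia.
    have := r_ge0 hi'; rewrite le_eqVlt => /predU1P[<-|ri]; first by rewrite mul0r.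
    rewrite below0 ?mulr0 // => y yx oy.
    have := @opt_order i j y (B j.-1) ltac:(nat_lia) ltac:(nat_lia) ltac:(nat_lia) oy ob1.
    by rewrite leNgt (lt_le_trans yx Bx2).
  rewrite big_ltn; last by nat_lia.
  rewrite addrC; congr (_ + _); rewrite /tail; apply: eq_big_nat => i hi.
  have hi' : (1 <= i <= n)%N by nat_lia.
  have := r_ge0 hi'; rewrite le_eqVlt => /predU1P[<-|ri]; first by rewrite mul0r.
  rewrite below_eq1 ?mulr1 //; apply: null_ge => // y xy oy.
  have := @opt_order j i (B j) y ltac:(nat_lia) ltac:(nat_lia) ltac:(nat_lia) ob2 oy.
  by rewrite leNgt (le_lt_trans Bx1 xy).
Qed.

End NodeEquilibrium.

(** * Payoffs in the game *)

Section Measurability.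
Variables (R : realType) (P : probability R R).

Lemma measurable_below_fun : measurable_fun [set: R] (below P).
Proof. by apply: nondecreasing_measurable => // x y; exact: below_le. Qed.

(** The atom at [x] is a difference of two nondecreasing functions of [x]. *)
Lemma measurable_atom : measurable_fun [set: R] (fun x => fine (P [set x])).
Proof.
pose upto x := fine (P [set y | y <= x]).
have mle (x : R) : measurable [set y : R | y <= x].
  have -> : [set y | y <= x] = `]-oo, x]%classic by apply/seteqP; split => y /=; rewrite in_itv.
  exact: measurable_itv.
rewrite (_ : (fun x => _) = upto \- below P); last first.
  apply/funext => x /=; rewrite /upto.
  have -> : [set y | y <= x] = [set y | y < x] `|` [set x].
    apply/seteqP; split => y /=; first by rewrite le_eqVlt => /predU1P[->|]; [right|left].
    by case=> [/ltW|->].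
  rewrite fine_probU //; first by rewrite /below; ring.
    exact: measurable_ray.
  by move=> y /= [] /[swap] ->; rewrite ltxx.
apply: measurable_funB; last exact: measurable_below_fun.
apply: nondecreasing_measurable => // x y xy; apply: fine_prob_le => // z /=.
by move=> /le_trans; apply.
Qed.

Lemma measurable_tie_sale (N m : nat) (a b : R -> R) :
  measurable_fun [set: R] a -> measurable_fun [set: R] b ->
  measurable_fun [set: R] (fun x => tie_sale N m (a x) (b x)).
Proof.
move=> ma mb; apply: measurable_sum => cl; apply: measurable_funM; last exact: measurable_cst.
apply: measurable_prod => k _; rewrite /class_weight.
case: (val (cl k) == 0%N) => //; case: (val (cl k) == 1%N) => //.
by apply: measurable_funB => //; apply: measurable_funB => //; exact: measurable_cst.
Qed.

End Measurability.

(** * Best replies and the equilibrium condition *)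

Section Game.
Variables (R : realType) (M l m n : nat) (q : nat -> R) (c v : R) (g f : nat -> R -> R).
Hypotheses (hm1 : (1 <= m)%N) (hml : (m < l)%N).
Hypothesis hq_pos : forall j, (1 <= j <= n)%N -> 0 < q j.
Hypothesis hq_sum : \sum_(1 <= j < n.+1) q j < 1.
Hypothesis mk : regular_market n c v g f.

Local Notation phi := (@sale R l.-1 m).
Local Notation tie := (@tie_sale R l.-1 m).
Local Notation payoff_at := (node_payoff l m n q c v f).

Lemma game_sale_curve : sale_curve phi.
Proof. by apply: sale_curve_sale => //; lia. Qed.
Let sc := game_sale_curve.

Section Strategy.
Variable psi : strategy R M.
Hypothesis psi_valid : valid_strategy n psi.

Definition node_mass (s : 'I_M) (j : nat) : R := q j * node_prob (psi j) s.

Lemma node_prob_ge0 j s : (1 <= j <= n)%N -> 0 <= node_prob (psi j) s.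
Proof. by move=> /psi_valid[h0 _]; apply: sumr_ge0 => I _; exact: h0. Qed.

Lemma node_prob_le1 j s : (1 <= j <= n)%N -> node_prob (psi j) s <= 1.
Proof.
move=> /psi_valid[h0 [<- _]]; rewrite /node_prob [leRHS](bigID (fun I : {set 'I_M} => s \in I)) /=.
by rewrite lerDl; apply: sumr_ge0 => I _; exact: h0.
Qed.

Lemma node_mass_ge0 s j : (1 <= j <= n)%N -> 0 <= node_mass s j.
Proof. by move=> hj; rewrite mulr_ge0 ?node_prob_ge0 // ltW // hq_pos. Qed.

Lemma node_mass_tail_le s j : (1 <= j)%N -> tail n (node_mass s) j <= tail n q j.
Proof.
move=> j1; apply: ler_sum_nat => i hi; have hi' : (1 <= i <= n)%N by lia.
by rewrite ler_piMr ?node_prob_le1 // ltW // hq_pos.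
Qed.

Lemma node_mass_tail1 s : tail n (node_mass s) 1%N < 1.
Proof. by apply: le_lt_trans (@node_mass_tail_le s 1%N isT) _; exact: hq_sum. Qed.

Lemma sale_probE s x : sale_prob l m n q psi s x = tie (pi_lt n q psi s x) (pi_eq n q psi s x).
Proof.
apply: eq_bigr => cl _; congr (_ * sale_share R m _ _); apply: eq_card => k.
  by rewrite inE; apply/idP/idP; rewrite inE.
by rewrite inE; apply/idP/idP; rewrite inE.
Qed.

Lemma node_payoffE j s x : payoff_at psi j s x =
  offer_value n c v f (node_mass s) (fun j => cpen (psi j) s) tie j x.
Proof. by rewrite /node_payoff sale_probE. Qed.

Lemma measurable_node_payoff j s : (1 <= j <= n)%N -> measurable_fun [set: R] (payoff_at psi j s).
Proof.
move=> hj; apply: measurable_fun_ifT.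
- by apply: measurable_fun_ler => //; exact: measurable_cst.
- apply: measurable_funM.
    apply: measurable_funB; last exact: measurable_cst.
    by apply: nondecreasing_measurable => // x y; rewrite (f_incr_le mk hj).
  rewrite (_ : sale_prob l m n q psi s = fun x => tie (pi_lt n q psi s x) (pi_eq n q psi s x));
    last by apply/funext => x; rewrite sale_probE.
  apply: measurable_tie_sale.
    apply: measurable_sum => i; apply: measurable_funM; first exact: measurable_cst.
    exact: measurable_below_fun.
  apply: measurable_sum => i; apply: measurable_funM; first exact: measurable_cst.
  exact: measurable_atom.
- exact: measurable_cst.
Qed.

Lemma payoff_bound j s x : (1 <= j <= n)%N -> payoff_at psi j s x <= f j v - c.
Proof.
move=> hj.
have fv : 0 < f j v - c.
  have cv := market_v mk; rewrite subr_gt0; have [->//|j1] := eqVneq j 1%N.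
  by apply: lt_trans cv _; apply: (f_state mk) => //; lia.
have lt_ge0 : 0 <= pi_lt n q psi s x.
  rewrite /pi_lt big_nat_cond; apply: sumr_ge0 => i hi.
  by rewrite mulr_ge0 ?below_ge0 //; apply: node_mass_ge0; lia.
have eq_ge0 : 0 <= pi_eq n q psi s x.
  rewrite /pi_eq big_nat_cond; apply: sumr_ge0 => i hi.
  by rewrite mulr_ge0 ?fine_prob_ge0 //; apply: node_mass_ge0; lia.
have le1 : pi_lt n q psi s x + pi_eq n q psi s x < 1.
  apply: le_lt_trans (node_mass_tail1 s); rewrite -big_split /=.
  apply: ler_sum_nat => i hi; rewrite -mulrDr.
  by apply: ler_piMr; [apply: node_mass_ge0; lia|exact: below_atom_le1].
have m_le : (m <= l.-1)%N by lia.
have tie_ge : phi (pi_lt n q psi s x + pi_eq n q psi s x) <= tie (pi_lt n q psi s x) (pi_eq n q psi s x).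
  by apply: tie_sale_ge => //; exact: ltW.
have tie_le : tie (pi_lt n q psi s x) (pi_eq n q psi s x) <= phi (pi_lt n q psi s x).
  by apply: tie_sale_le => //; exact: ltW.
have tie0 : 0 <= tie (pi_lt n q psi s x) (pi_eq n q psi s x).
  by apply: le_trans tie_ge; apply/ltW/(curve_gt0 sc) => //; exact: addr_ge0.
have tie1 : tie (pi_lt n q psi s x) (pi_eq n q psi s x) <= 1.
  apply: le_trans tie_le _; rewrite -(curve0 sc); apply: (curve_anti sc) => //.
  by apply: le_trans (ltW le1); rewrite lerDl.
rewrite /node_payoff; case: ifP => xv; last exact: ltW.
rewrite sale_probE; apply: (@le_trans _ _ ((f j v - c) * tie (pi_lt n q psi s x) (pi_eq n q psi s x))).
  by rewrite ler_wpM2r // lerD2r (f_incr_le mk hj).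
by rewrite ler_piMr // ltW.
Qed.

(** A supremum, since possible ties leave open at this stage whether a best penalty exists. *)
Definition best (j : nat) (s : 'I_M) : R := sup (range (payoff_at psi j s)).

Let best_sup j s : (1 <= j <= n)%N -> has_sup (range (payoff_at psi j s)).
Proof.
move=> hj; split; first by exists (payoff_at psi j s 0), 0.
by exists (f j v - c) => _ [x _ <-]; exact: payoff_bound.
Qed.

Lemma best_ub j s x : (1 <= j <= n)%N -> payoff_at psi j s x <= best j s.
Proof. by move=> hj; apply: sup_upper_bound; [exact: best_sup|exists x]. Qed.

Lemma best_adherent j s e : (1 <= j <= n)%N -> 0 < e ->
  exists x, best j s - e < payoff_at psi j s x.
Proof. by move=> hj e0; have [_ [x _ <-] h] := sup_adherent e0 (best_sup s hj); exists x. Qed.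

Lemma best_ge0 j s : (1 <= j <= n)%N -> 0 <= best j s.
Proof.
(* A penalty above [v] is never sold and earns 0. *)
move=> hj; apply: le_trans (best_ub s (v + 1) hj).
by rewrite /node_payoff gerDl ler10.
Qed.

Definition pure_choice (I : {set 'I_M}) (x : 'I_M -> R) : Defs.choice R M :=
  Defs.Choice [ffun J => (J == I)%:R] (fun s => \d_(x s) : probability R R).

Lemma pure_choice_valid I x : indep I -> valid_choice (pure_choice I x).
Proof.
move=> indI; split=> [J|]; first by rewrite /= ffunE.
split=> [|J]; last by rewrite /= ffunE; case: (J =P I) => [->//|_]; rewrite eqxx.
rewrite (bigD1 I) //= ffunE eqxx big1 ?addr0 // => J /negbTE JI.
by rewrite ffunE JI.
Qed.

Lemma payoff_pure j I x : (1 <= j <= n)%N ->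
  payoff l m n q c v f psi j (pure_choice I x) = (\sum_(s in I) payoff_at psi j s (x s))%:E.
Proof.
move=> hj; rewrite /payoff (bigD1 I) //= ffunE eqxx mul1e [X in (_ + X)%E]big1 ?adde0.
  rewrite -sumEFin; apply: eq_bigr => s _.
  have := @integral_dirac _ R (x s) R setT measurableT (fun y => (payoff_at psi j s y)%:E).
  rewrite diracT mul1e; apply; apply/measurable_EFinP.
  exact: measurable_node_payoff.
by move=> J /negbTE JI; rewrite ffunE JI mul0e.
Qed.

(** The deviation to [I] with fixed penalties that are nearly best at each node; at most [M] nodes
    share the error [e]. *)
Lemma payoff_ge_best j I : (1 <= j <= n)%N -> indep I ->
  (forall ch, valid_choice ch -> (payoff l m n q c v f psi j ch <= payoff l m n q c v f psi j (psi j))%E) ->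
  ((\sum_(s in I) best j s)%:E <= payoff l m n q c v f psi j (psi j))%E.
Proof.
move=> hj indI ne; apply/lee_addgt0Pr => e e_gt0.
have e'_gt0 : 0 < e / M.+1%:R by rewrite divr_gt0.
have /choice [x hx] : forall s, exists x, best j s - e / M.+1%:R < payoff_at psi j s x.
  by move=> s; exact: best_adherent.
apply: (@le_trans _ _ ((\sum_(s in I) payoff_at psi j s (x s))%:E + e%:E)%E); last first.
  by rewrite leeD2r // -payoff_pure //; apply/ne/pure_choice_valid.
rewrite -EFinD lee_fin.
apply: (@le_trans _ _ (\sum_(s in I) (payoff_at psi j s (x s) + e / M.+1%:R))).
  by apply: ler_sum => s _; rewrite -lerBlDr ltW.
rewrite big_split /= lerD2l sumr_const -[X in X <= _]mulr_natr mulrAC.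
rewrite ler_pdivrMr ?ltr0n // ler_pM2l // ler_nat.
by apply: leq_trans (max_card _) _; rewrite card_ord.
Qed.

(** The equilibrium payoff averages, over the sets in use, expected payoffs that are at most the
    maximal weight of an independent set, and it reaches this maximum. So each set in use attains
    it, and within such a set each node attains its own best value almost surely. *)
Lemma NE_support j : (1 <= j <= n)%N ->
  (forall ch, valid_choice ch -> (payoff l m n q c v f psi j ch <= payoff l m n q c v f psi j (psi j))%E) ->
  (forall I J, csel (psi j) I != 0 -> indep J -> \sum_(s in J) best j s <= \sum_(s in I) best j s) /\
  (forall s, 0 < node_prob (psi j) s -> cpen (psi j) s [set x | payoff_at psi j s x < best j s] = 0%E).
Proof.
move=> hj ne; have [sel_ge0 [sel_sum sel_indep]] := psi_valid hj.
have [I0 I0_indep I0_max] : exists2 I0 : {set 'I_M}, indep I0 &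
    forall J, indep J -> \sum_(s in J) best j s <= \sum_(s in I0) best j s.
  have indep0 : indep (finset.set0 : {set 'I_M}).
    by apply/forallP => i; apply/forallP => k; rewrite !inE.
  case: (@arg_maxP _ R _ finset.set0 (@indep M) (fun J => \sum_(s in J) best j s) indep0).
  by move=> I0 indI0 maxI0; exists I0.
pose E s := (\int[cpen (psi j) s]_x (payoff_at psi j s x)%:E)%E.
have E_le s : (E s <= (best j s)%:E)%E.
  apply: integral_prob_le; [exact: measurable_node_payoff|exact: best_ge0|].
  by move=> x; exact: best_ub.
have sumE_le (I : {set 'I_M}) : (\sum_(s in I) E s <= (\sum_(s in I) best j s)%:E)%E.
  by rewrite -sumEFin; apply: lee_sum => s _; exact: E_le.
have val_I (I : {set 'I_M}) : csel (psi j) I != 0 -> (\sum_(s in I) E s = (\sum_(s in I0) best j s)%:E)%E.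
  move=> selI; apply: (@weighted_sum_eq _ _ predT (csel (psi j)) (fun=> \sum_(s in I0) best j s)
    (fun I => \sum_(s in I) E s)%E) => // [J _ selJ||].
  - apply: le_trans (sumE_le J) _; rewrite lee_fin; exact/I0_max/sel_indep.
  - rewrite -mulr_suml sel_sum mul1r.
    exact: payoff_ge_best.
  - by rewrite lt_neqAle eq_sym selI sel_ge0.
split=> [I J selI indJ|s].
  apply: le_trans (I0_max J indJ) _.
  by have := sumE_le I; rewrite val_I // lee_fin.
move=> ps; have [I sI selI] : exists2 I : {set 'I_M}, s \in I & csel (psi j) I != 0.
  apply: contrapT => no; move: ps; rewrite /node_prob big1 ?ltxx // => I sI.
  by apply/eqP/negPn/negP => h; apply: no; exists I.
apply: integral_prob_eq_null; [exact: measurable_node_payoff|exact: best_ge0| |].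
  by move=> x; exact: best_ub.
rewrite -/(E s).
apply: (@weighted_sum_eq _ _ (mem I) (fun=> 1) (best j) E) => //.
rewrite [X in X%:E](eq_bigr (best j)) ?[X in (_ <= X)%E](eq_bigr E); last 2 first.
- by move=> i _; rewrite mul1e.
- by move=> i _; rewrite mul1r.
rewrite val_I // lee_fin; apply: I0_max; exact: sel_indep.
Qed.

(** A certificate of optimality: [V] bounds the payoffs at the nodes, is earned almost surely at the
    nodes in use, and gives the sets in use maximal weight. *)
Lemma NE_sufficient (V : nat -> 'I_M -> R) :
  (forall j s, (1 <= j <= n)%N -> 0 <= V j s) ->
  (forall j s x, (1 <= j <= n)%N -> payoff_at psi j s x <= V j s) ->
  (forall j I J, (1 <= j <= n)%N -> csel (psi j) I != 0 -> indep J ->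
    \sum_(s in J) V j s <= \sum_(s in I) V j s) ->
  (forall j s, (1 <= j <= n)%N -> 0 < node_prob (psi j) s ->
    cpen (psi j) s [set x | payoff_at psi j s x < V j s] = 0%E) ->
  sym_NE l m n q c v f psi.
Proof.
move=> V_ge0 V_ub V_opt V_null; split=> // j hj ch [ch_ge0 [ch_sum ch_indep]].
have [sel_ge0 [sel_sum sel_indep]] := psi_valid hj.
have [I0 selI0] : exists I0, csel (psi j) I0 != 0.
  apply: contrapT => no; move: sel_sum; rewrite big1 => [/eqP|I _].
    by rewrite eq_sym oner_eq0.
  by apply/eqP/negPn/negP => h; apply: no; exists I.
pose W := \sum_(s in I0) V j s.
apply: (@le_trans _ _ W%:E).
  rewrite -[leRHS]mul1e -ch_sum -sumEFin ge0_sume_distrl //; last by move=> I _; rewrite lee_fin.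
  apply: lee_sum => I _; have [->|chI] := eqVneq (csel ch I) 0; first by rewrite !mul0e.
  apply: lee_wpmul2l; first by rewrite lee_fin.
  apply: (@le_trans _ _ (\sum_(s in I) V j s)%:E); last first.
    by rewrite lee_fin; apply: V_opt => //; exact: ch_indep.
  rewrite -sumEFin; apply: lee_sum => s _.
  apply: integral_prob_le; [exact: measurable_node_payoff|exact: V_ge0|].
  by move=> x; exact: V_ub.
rewrite -[leLHS]mul1e -sel_sum -sumEFin ge0_sume_distrl //; last by move=> I _; rewrite lee_fin.
apply: lee_sum => I _; have [->|selI] := eqVneq (csel (psi j) I) 0; first by rewrite !mul0e.
apply: lee_wpmul2l; first by rewrite lee_fin.
apply: (@le_trans _ _ (\sum_(s in I) V j s)%:E).
  by rewrite lee_fin; apply: V_opt => //; exact: sel_indep.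
rewrite -sumEFin; apply: lee_sum => s sI; rewrite (@integral_prob_null_eq _ _ _ _ _ (V j s)) //.
- exact: measurable_node_payoff.
- by move=> x; exact: V_ub.
apply: V_null => //; rewrite /node_prob (bigD1 I) //=; apply: ltr_pwDl.
  by rewrite lt_neqAle eq_sym selI sel_ge0.
by apply: sumr_ge0 => J _; exact: sel_ge0.
Qed.

End Strategy.
End Game.

(** * Independent sets of the path *)

(** Open lower rays are closed under intersection and generate the Borel sets. *)
Lemma prob_eq_below (R : realType) (P P' : probability R R) :
  (forall x, below P x = below P' x) -> forall A, measurable A -> P A = P' A.
Proof.
move=> PP' A mA; have ray (x : R) : `]-oo, x[%classic = [set y | y < x].
  by apply/seteqP; split => y /=; rewrite in_itv.
apply: (@measure_unique _ _ _ (@RGenInftyO.G R) (fun k => `]-oo, k%:R[%classic)) => //.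
- exact: RGenInftyO.measurableE.
- move=> _ _ [x ->] [y ->]; exists (Num.min x y); rewrite !ray.
  by apply/seteqP; split => z /=; rewrite lt_min; [case=> -> ->|case/andP].
- by move=> k; exists k%:R.
- apply/seteqP; split => // x _; exists (Num.truncn `|x|).+1 => //=.
  by rewrite in_itv /=; apply: le_lt_trans (ler_norm x) _; exact: truncnS_gt.
- move=> _ [x ->]; rewrite ray; have := PP' x; rewrite /below => e.
  by rewrite -[LHS]fineK ?e ?fineK ?fin_num_measure //; exact: measurable_ray.
- move=> k; rewrite ray; apply: le_lt_trans (probability_le1 _ _) _; last by rewrite ltry.
  exact: measurable_ray.
Qed.

Lemma half_double_bounds a : (a./2.*2 <= a <= a./2.*2.+1)%N.
Proof. by rewrite -{2 3}[a]odd_double_half leq_addl /= -add1n leq_add2r leq_b1. Qed.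

Section PathGraph.
Variable M : nat.
Implicit Types (I J : {set 'I_M}) (s p : 'I_M).

Lemma path_adjC s p : path_adj s p = path_adj p s.
Proof. by rewrite /path_adj orbC. Qed.

Lemma path_adjxx s : path_adj s s = false.
Proof. by rewrite /path_adj orbb; apply/negbTE; rewrite neq_ltn ltnSn orbT. Qed.

Lemma indepP I : reflect (forall s p, s \in I -> p \in I -> ~~ path_adj s p) (indep I).
Proof.
apply: (iffP forallP) => [h s p sI pI|h s].
  by move/forallP: (h s) => /(_ p); rewrite sI pI.
by apply/forallP => p; apply/implyP => /andP[]; exact: h.
Qed.

Lemma indep_sub I J : J \subset I -> indep I -> indep J.
Proof. by move=> /fintype.subsetP JI /indepP h; apply/indepP => s p /JI sI /JI pI; exact: h. Qed.

Lemma indep_add I s : indep I -> (forall p, p \in I -> ~~ path_adj s p) -> indep (s |: I).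
Proof.
move=> /indepP h hs; apply/indepP => a b; rewrite !inE.
case/predU1P => [->|aI]; case/predU1P => [->|bI].
- by rewrite path_adjxx.
- exact: hs.
- by rewrite path_adjC; exact: hs.
- exact: h.
Qed.

Lemma I_odd_indep : indep (I_odd M).
Proof.
by apply/indepP => s p; rewrite !inE /path_adj => os op; apply/negP => /orP[]/eqP e;
   move: os op; rewrite -e /=; case: (odd _).
Qed.

Lemma I_even_indep : indep (I_even M).
Proof.
by apply/indepP => s p; rewrite !inE /path_adj => os op; apply/negP => /orP[]/eqP e;
   move: os op; rewrite -e /=; case: (odd _).
Qed.

Lemma alternating_set I : (0 < M)%N ->
  (forall s p : 'I_M, s.+1 = p :> nat -> (p \in I) = (s \notin I)) ->
  I = I_odd M \/ I = I_even M.
Proof.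
move=> M0 alt; pose z : 'I_M := Ordinal M0.
have mem t : forall s : 'I_M, s = t :> nat -> (s \in I) = ((z \in I) (+) odd t).
  elim: t => [|t IH] s st; first by rewrite addbF; congr (_ \in I); exact: val_inj.
  have tM : (t < M)%N by have := ltn_ord s; rewrite st; lia.
  by rewrite (alt (Ordinal tM)) ?st // IH //= addbN.
have [zI|zI] := boolP (z \in I); [left|right]; apply/finset.setP => s;
  by rewrite (mem s) // ?zI ?(negbTE zI) inE.
Qed.

(** * Exchanges in independent sets of maximal weight *)

Section NodeWeights.
Variables (R : realType) (w : 'I_M -> R) (I : {set 'I_M}).
Hypothesis w_gt0 : forall s, 0 < w s.
Hypothesis I_indep : indep I.
Hypothesis I_opt : forall J, indep J -> \sum_(s in J) w s <= \sum_(s in I) w s.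

(** Replacing [p] by [s] keeps [I] independent, as [p] is the only neighbour of [s] that [I] can
    contain. The case [p \notin I] is included, so it need not be known whether [p] is selected. *)
Lemma swap_weight s p : s \notin I ->
  (forall p', p' \in I -> path_adj s p' -> p' = p) -> w s <= w p.
Proof.
move=> sI adj.
have indJ : indep (s |: (I :\ p)).
  apply: indep_add; first by apply: indep_sub I_indep; exact: finset.subsetDl.
  move=> p'; rewrite !inE => /andP[pp' p'I]; apply/negP => /(adj _ p'I) e.
  by rewrite e eqxx in pp'.
have := I_opt indJ; rewrite big_setU1 /=; last by rewrite !inE (negbTE sI) andbF.
have [pI|pI] := boolP (p \in I).
  by rewrite [leRHS](big_setD1 p) //= lerD2r.
rewrite (_ : I :\ p = I); last by apply/finset.setDidPl; rewrite disjoint_sym disjoints1.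
rewrite gerDr => ws; apply: le_trans ws _; exact: ltW.
Qed.

Lemma isolated_weight s : (forall p, p \in I -> ~~ path_adj s p) -> s \in I.
Proof.
move=> adj; apply/negPn/negP => sI; have := I_opt (indep_add I_indep adj).
by rewrite big_setU1 //= gerDr leNgt w_gt0.
Qed.

End NodeWeights.

Lemma card_even_le_odd : (#|I_even M| <= #|I_odd M|)%N.
Proof.
case: (posnP M) => [M0|M0].
  by apply: leq_trans (max_card _) _; rewrite card_ord M0.
have predM (s : 'I_M) : (s.-1 < M)%N by have := ltn_ord s; lia.
pose h (s : 'I_M) : 'I_M := Ordinal (predM s).
have hI : {in I_even M &, injective h}.
  move=> s p; rewrite !inE => os op /(congr1 val) /= e; apply: val_inj => /=.
  by move: os op e; case: (nat_of_ord s) => // a; case: (nat_of_ord p) => //= b _ _ ->.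
rewrite -(card_in_imset hI); apply/subset_leq_card/fintype.subsetP => _ /imsetP[s sE ->].
by move: sE; rewrite !inE /=; case: (nat_of_ord s) => //= a; rewrite negbK.
Qed.

Lemma card_odd_gt0 : (0 < M)%N -> (0 < #|I_odd M|)%N.
Proof. by move=> M0; apply/card_gt0P; exists (Ordinal M0); rewrite inE. Qed.

Lemma card_even_gt0 : (1 < M)%N -> (0 < #|I_even M|)%N.
Proof. by move=> M1; apply/card_gt0P; exists (Ordinal M1); rewrite inE. Qed.

Lemma I_odd_neq_even : (0 < M)%N -> I_odd M != I_even M.
Proof.
move=> M0; apply/eqP => /finset.setP/(_ (Ordinal M0)); by rewrite !inE.
Qed.

(** The nodes [2k] and [2k+1] are adjacent, so rounding indices down to an even number is injective
    on an independent set. *)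
Lemma indep_card_le I : indep I -> (#|I| <= #|I_odd M|)%N.
Proof.
case: (posnP M) => [M0 _|M0 /indepP indI].
  by apply: leq_trans (max_card _) _; rewrite card_ord M0.
have evM (s : 'I_M) : (s./2.*2 < M)%N.
  by apply: leq_ltn_trans (ltn_ord s); rewrite -[leqRHS]odd_double_half leq_addl.
pose h (s : 'I_M) : 'I_M := Ordinal (evM s).
have hI : {in I &, injective h}.
  move=> s p sI pI /(congr1 val) /= /double_inj e; apply: val_inj => /=.
  have := indI s p sI pI; rewrite /path_adj.
  by have := half_double_bounds s; have := half_double_bounds p; rewrite e; lia.
rewrite -(card_in_imset hI); apply/subset_leq_card/fintype.subsetP => _ /imsetP[s sE ->].
by rewrite inE /= odd_double.
Qed.

(* A path with an odd number of nodes has only one maximum independent set. *)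
Lemma indep_card_lt I s : odd M -> indep I -> s \in I -> odd s -> (#|I| <= #|I_even M|)%N.
Proof.
move=> oM /indepP indI sI os.
(* Nodes are paired as [2k], [2k+1] to the left of [s] and as [2k+1], [2k+2] from [s] on, each pair
   going to [2k+1]. Thus [s] goes to itself, and only its neighbour [s-1], which is not in [I],
   could collide with it across the change of pairing. *)
have bound (p : 'I_M) : p \in I -> ((if (p < s)%N then p./2 else p.-1./2).*2.+1 < M)%N.
  move=> pI; have := ltn_ord p; have := ltn_ord s; have := half_double_bounds p.
  have := half_double_bounds p.-1; have := odd_double_half s.
  by rewrite os; case: (ltnP p s); lia.
have M0 : (0 < M)%N by case: (M) oM.
pose h (p : 'I_M) : 'I_M :=
  insubd (Ordinal M0) (if (p < s)%N then p./2 else p.-1./2).*2.+1.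
have hE p : p \in I -> h p = (if (p < s)%N then p./2 else p.-1./2).*2.+1 :> nat.
  by move=> pI; rewrite /h val_insubd bound.
have hI : {in I &, injective h}.
  move=> a b aI bI /(congr1 val) /=; rewrite !hE // => -[] /double_inj e; apply: val_inj => /=.
  have := half_double_bounds a; have := half_double_bounds b.
  have := half_double_bounds a.-1; have := half_double_bounds b.-1; have := odd_double_half s.
  have := indI a b aI bI; have := indI s a sI aI; have := indI s b sI bI.
  by move: e; rewrite /path_adj os; case: (ltnP a s); case: (ltnP b s); lia.
rewrite -(card_in_imset hI); apply/subset_leq_card/fintype.subsetP => _ /imsetP[p pI ->].
by rewrite inE hE //= odd_double.
Qed.

(** If [y <= x], counting nodes suffices. If [x < y], the hypothesis forces strictly fewer
    even-numbered than odd-numbered nodes, so [M] is odd; then a set with an even-numbered node has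
    at most [#|I_even M|] nodes, each of weight at most [y], and any other set has only weights
    [x]. *)
Lemma indep_weight_le (R : realType) (x y : R) I : (1 < M)%N -> 0 <= x -> 0 <= y ->
  #|I_even M|%:R * y <= #|I_odd M|%:R * x -> indep I ->
  \sum_(s in I) (if odd s then y else x) <= #|I_odd M|%:R * x.
Proof.
move=> M1 x0 y0 le_xy indI.
have le_cst z J : (forall s : 'I_M, s \in J -> (if odd s then y else x) <= z) ->
    \sum_(s in J) (if odd s then y else x) <= #|J|%:R * z.
  move=> h; apply: (@le_trans _ _ (\sum_(s in J) z)); first exact: ler_sum.
  by rewrite sumr_const mulr_natl.
have [yx|xy] := leP y x.
  apply: le_trans (le_cst x I _) _; first by move=> s _; case: ifP.
  by rewrite ler_wpM2r // ler_nat indep_card_le.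
have [/existsP[s /andP[sI os]]|/existsPn none] := boolP [exists s, (s \in I) && odd s].
  have oM : odd M.
    apply/negPn/negP => eM; have : (#|I_even M| = #|I_odd M|)%N.
      apply/eqP; rewrite eqn_leq card_even_le_odd /=.
      pose h (p : 'I_M) : 'I_M := insubd p p.+1.
      have bound (p : 'I_M) : ~~ odd p -> (p.+1 < M)%N.
        move=> ep; rewrite ltn_neqAle ltn_ord andbT; apply/eqP => e.
        by move: eM; rewrite -e /= negbK (negbTE ep).
      have hI : {in I_odd M &, injective h}.
        move=> a b; rewrite !inE => /bound ba /bound bb /(congr1 val) /=.
        by rewrite !val_insubd ba bb => -[] e; apply: val_inj.
      rewrite -(card_in_imset hI); apply/subset_leq_card/fintype.subsetP => _ /imsetP[p pI ->].
      by move: pI; rewrite !inE => ep; rewrite val_insubd bound //= ep.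
    move=> e; move: le_xy; rewrite e ler_pM2l ?leNgt ?xy //.
    by rewrite ltr0n card_odd_gt0 // ltnW.
  apply: le_trans (le_cst y I _) _; first by move=> p _; case: ifP => // _; exact: ltW.
  apply: le_trans le_xy; rewrite ler_wpM2r // ler_nat; exact: indep_card_lt sI os.
apply: le_trans (le_cst x I _) _.
  by move=> s sI; have := none s; rewrite sI /= => /negbTE ->.
by rewrite ler_wpM2r // ler_nat indep_card_le.
Qed.

End PathGraph.

(** * Uniqueness *)

Section Uniqueness.
Variables (R : realType) (M l m n : nat) (q : nat -> R) (c v : R) (g f : nat -> R -> R).
Hypotheses (hM : (2 <= M)%N) (hm1 : (1 <= m)%N) (hml : (m < l)%N) (hn : (1 <= n)%N).
Hypothesis hq_pos : forall j, (1 <= j <= n)%N -> 0 < q j.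
Hypothesis hq_sum : \sum_(1 <= j < n.+1) q j < 1.
Hypothesis mk : regular_market n c v g f.

Local Notation phi := (@sale R l.-1 m).
Local Notation tie := (@tie_sale R l.-1 m).
Let sc : sale_curve phi. Proof. by apply: sale_curve_sale => //; nat_lia. Qed.

Let m_le : (m <= l.-1)%N. Proof. by nat_lia. Qed.
Let M_gt0 : (0 < M)%N. Proof. by nat_lia. Qed.

(** Addresses nodes by natural numbers; the remainder only makes the function total. *)
Definition node_at (t : nat) : 'I_M := Ordinal (ltn_pmod t M_gt0).

Lemma node_atK t : (t < M)%N -> node_at t = t :> nat.
Proof. by move=> tM /=; rewrite modn_small. Qed.

Lemma node_at_id (s : 'I_M) : node_at s = s.
Proof. by apply: val_inj; rewrite /= modn_small. Qed.

Lemma node_at_adj t : (t.+1 < M)%N -> path_adj (node_at t) (node_at t.+1).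
Proof. by move=> tM; rewrite /path_adj !node_atK ?eqxx //; nat_lia. Qed.

Lemma adj_node_at (s p : 'I_M) t : s = t :> nat -> path_adj s p ->
  (p = t.+1 :> nat) \/ (p.+1 = t :> nat).
Proof. by rewrite /path_adj => -> /orP[]/eqP ->; [left|right]. Qed.

Section Equilibrium.
Variable psi : strategy R M.
Hypothesis ne : sym_NE l m n q c v f psi.
Let psi_valid : valid_strategy n psi. Proof. by case: ne. Qed.
Local Notation mass := (node_mass q psi).
Local Notation T s := (tail n (mass s)).
Local Notation W j s := (nodeval c v g f phi (T s) j).
Local Notation V := (best l m n q c v f psi).
Local Notation offer s := (offer_value n c v f (mass s) (fun j => cpen (psi j) s) tie).

Let r_ge0 s j : (1 <= j <= n)%N -> 0 <= mass s j.
Proof. exact: (node_mass_ge0 hq_pos psi_valid). Qed.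
Let r_sum s : T s 1%N < 1.
Proof. exact: (node_mass_tail1 hm1 hml hq_pos hq_sum psi_valid). Qed.
Let hT s j : (1 <= j <= n.+1)%N -> 0 <= T s j < 1.
Proof. by apply: tail_lt1 => // i; exact: r_ge0. Qed.
Let tie_ge p0 p1 : 0 <= p0 -> 0 <= p1 -> p0 + p1 <= 1 -> phi (p0 + p1) <= tie p0 p1.
Proof. exact: tie_sale_ge. Qed.
Let tie_lt p0 p1 : 0 <= p0 -> 0 < p1 -> p0 + p1 <= 1 -> tie p0 p1 < phi p0.
Proof. by move=> *; apply: tie_sale_lt => //; exact: ltW. Qed.
Let V_ub s j x : (1 <= j <= n)%N -> offer s j x <= V j s.
Proof. by move=> hj; rewrite -node_payoffE; exact: (best_ub hm1 hml hq_pos hq_sum mk). Qed.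
Let V_sup s j e : (1 <= j <= n)%N -> 0 < e -> exists x, V j s - e < offer s j x.
Proof.
move=> hj e0; have [x hx] := best_adherent hm1 hml hq_pos hq_sum mk psi_valid s hj e0.
by exists x; rewrite -node_payoffE.
Qed.
Let V_supp s j (A : set R) : (1 <= j <= n)%N -> 0 < mass s j -> measurable A ->
  (forall x, A x -> offer s j x < V j s) -> cpen (psi j) s A = 0%E.
Proof.
move=> hj rj mA sub.
have [_ null] := NE_support hm1 hml hq_pos hq_sum mk psi_valid hj (ne.2 j hj).
apply: (subset_measure0 mA _ _ (null s _)).
- by apply: measurable_below; exact: (measurable_node_payoff _ _ _ mk).
- by move=> x /sub; rewrite -node_payoffE.
- by move: rj; rewrite pmulr_rgt0 ?hq_pos.
Qed.

Lemma NE_value j s : (1 <= j <= n)%N -> V j s = W j s.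
Proof.
move=> hj; exact: (node_value hn mk sc (r_ge0 s) (r_sum s) (fun=> erefl) tie_ge tie_lt
  (@V_ub s) (@V_sup s) (@V_supp s) hj).
Qed.

Lemma NE_cdf s j x : (1 <= j <= n)%N -> 0 < mass s j ->
  [/\ x <= brk c v g f phi (T s) j -> below (cpen (psi j) s) x = 0,
      brk c v g f phi (T s) j.-1 <= x -> below (cpen (psi j) s) x = 1 &
      brk c v g f phi (T s) j <= x <= brk c v g f phi (T s) j.-1 ->
        (f j x - c) * phi (T s j.+1 + mass s j * below (cpen (psi j) s) x) = W j s].
Proof.
move=> hj rj; exact: (node_cdf hn mk sc (r_ge0 s) (r_sum s) (fun=> erefl) tie_ge tie_lt
  (@V_ub s) (@V_sup s) (@V_supp s) x hj rj).
Qed.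

Lemma NE_opt j I J : (1 <= j <= n)%N -> csel (psi j) I != 0 -> indep J ->
  \sum_(s in J) W j s <= \sum_(s in I) W j s.
Proof.
move=> hj selI indJ.
have [opt _] := NE_support hm1 hml hq_pos hq_sum mk psi_valid hj (ne.2 j hj).
by have := opt I J selI indJ; under eq_bigr do rewrite NE_value //;
   under [X in _ <= X]eq_bigr do rewrite NE_value //.
Qed.

Let W_gt0 j s : (1 <= j <= n)%N -> 0 < W j s.
Proof. by move=> hj; apply: (nodeval_gt0 mk sc) => // i; exact: hT. Qed.

Definition skip_prob (ch : Defs.choice R M) (s p : 'I_M) : R :=
  \sum_(I : {set 'I_M} | (s \notin I) && (p \notin I)) csel ch I.

(** An independent set contains at most one end of an edge, which leaves three exclusive cases. *)
Lemma edge_prob (ch : Defs.choice R M) s p : valid_choice ch -> path_adj s p ->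
  node_prob ch s + node_prob ch p + skip_prob ch s p = 1.
Proof.
move=> [_ [<- ind]] adj.
rewrite [RHS](bigID (fun I : {set 'I_M} => s \in I)) /= -addrA; congr (_ + _).
rewrite [RHS](bigID (fun I : {set 'I_M} => p \in I)) /=; congr (_ + _).
rewrite /node_prob (bigID (fun I : {set 'I_M} => s \in I)) /= big1 ?add0r.
  by apply: eq_bigl => I; rewrite andbC.
move=> I /andP[pI sI]; apply/eqP/negPn/negP => /ind/indepP/(_ s p sI pI).
by rewrite adj.
Qed.

(** The value 0 out of range makes nonnegativity hold for all indices. *)
Let dm i t : R := if [&& (1 <= i)%N, (i <= n)%N & (t.+1 < M)%N] then
  q i * skip_prob (psi i) (node_at t) (node_at t.+1) else 0.

Let skip_ge0 i s p : (1 <= i <= n)%N -> 0 <= skip_prob (psi i) s p.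
Proof. by move=> /psi_valid[h0 _]; apply: sumr_ge0 => I _; exact: h0. Qed.

Let mass_edge i t : (1 <= i <= n)%N -> (t.+1 < M)%N ->
  mass (node_at t) i + mass (node_at t.+1) i + dm i t = q i.
Proof.
move=> hi tM; rewrite /dm tM andbT hi -!mulrDr edge_prob ?mulr1 //; first exact: psi_valid.
exact: node_at_adj.
Qed.

(** Some optimal set avoids both ends of the edge. If [t] or [t.+1] were an end of the path, it
    could be added to the set; otherwise [t] can replace [t.-1] and [t.+1] can replace [t.+2], and
    neither exchange may be profitable. *)
Let dm_pos i t : (1 <= i <= n)%N -> (t.+1 < M)%N -> 0 < dm i t ->
  [/\ (0 < t)%N, (t.+2 < M)%N, W i (node_at t) <= W i (node_at t.-1) &
      W i (node_at t.+1) <= W i (node_at t.+2)].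
Proof.
move=> hi tM dpos; have tM' : (t < M)%N by nat_lia.
have [I sI [pI selI]] : exists2 I : {set 'I_M}, node_at t \notin I &
    node_at t.+1 \notin I /\ csel (psi i) I != 0.
  apply: contrapT => no; move: dpos; rewrite /dm; case: ifP => _; rewrite ?ltxx //.
  rewrite /skip_prob big1 ?mulr0 ?ltxx // => I /andP[sI pI].
  by apply/eqP/negPn/negP => h; apply: no; exists I.
have indI : indep I by have [_ [_]] := psi_valid hi; apply.
have optI J : indep J -> \sum_(s in J) W i s <= \sum_(s in I) W i s by exact: NE_opt.
have pos s : 0 < W i s by exact: W_gt0.
have [t0|t0] := posnP t.
  exfalso; apply/negP: (sI); rewrite negbK; apply: (isolated_weight pos indI optI) => p pI'.
  apply/negP => /(adj_node_at (node_atK tM')) [e|]; last by nat_lia.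
  by move: pI; rewrite (_ : node_at t.+1 = p) ?pI' //; apply: val_inj; rewrite /= modn_small.
have [t2|t2] := ltnP t.+2 M; last first.
  exfalso; apply/negP: (pI); rewrite negbK; apply: (isolated_weight pos indI optI) => p pI'.
  apply/negP => /(adj_node_at (node_atK tM)) [e|[e]]; first by have := ltn_ord p; nat_lia.
  by move: sI; rewrite (_ : node_at t = p) ?pI' //; apply: val_inj; rewrite /= modn_small.
split => //.
  apply: (swap_weight pos indI optI sI) => p pI' /(adj_node_at (node_atK tM')) [e|e].
    by move: pI; rewrite (_ : node_at t.+1 = p) ?pI' //; apply: val_inj; rewrite /= modn_small.
  by apply: val_inj; rewrite /= modn_small -?e //; nat_lia.
apply: (swap_weight pos indI optI pI) => p pI' /(adj_node_at (node_atK tM)) [e|[e]].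
  by apply: val_inj; rewrite /= modn_small.
by move: sI; rewrite (_ : node_at t = p) ?pI' //; apply: val_inj; rewrite /= modn_small.
Qed.

Let tight i t : (1 <= i <= n)%N -> (t.+1 < M)%N -> dm i t = 0.
Proof.
have hT1 s j : (1 <= j <= n.+1)%N -> 0 <= T s j <= 1 by move=> /hT - /(_ s)/andP[-> /ltW].
have v0 : 0 < f 1%N v - c by rewrite subr_gt0 (market_v mk).
apply: (@all_edges_tight R n M (fun i t => W i (node_at t)) (fun i t => T (node_at t) i) dm).
- by move=> s p _ _ Tsp; rewrite /nodeval /= ler_pM2l // (curve_leP sc) ?hT1.
- by move=> s p _ _ Tsp; rewrite /nodeval /= ltr_pM2l // (curve_ltP sc) ?hT1.
(* Nodes are compared here without scaling, that is with [b = 1]. *)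
- move=> k s p k1 kn _ _ Wsp Tsp; rewrite -[leRHS]mul1r.
  apply: (nodeval_step mk sc) => //; rewrite ?mul1r //.
  - by move=> j; exact: hT.
  - by move=> j; exact: hT.
  - by rewrite (curve_leP sc) ?hT1 //; nat_lia.
- move=> k s p k1 kn _ _ Wsp Tsp; rewrite -[ltRHS]mul1r.
  apply: (nodeval_step_ltl mk sc) => //; rewrite ?mul1r //.
  - by move=> j; exact: hT.
  - by move=> j; exact: hT.
  - by rewrite (curve_leP sc) ?hT1 //; nat_lia.
- move=> k t'; rewrite /dm; case: ifP => // /and3P[k1 kn _].
  by rewrite mulr_ge0 ?skip_ge0 ?ltW ?hq_pos // k1.
(* Two consecutive edges share their middle node, whose mass cancels in the difference of the two
   edge identities. *)
- move=> k t' hk t2M; rewrite /tail -sumrB; apply: eq_big_nat => a ha.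
  have ha' : (1 <= a <= n)%N by nat_lia.
  have := mass_edge ha' (ltnW t2M); have := mass_edge ha' t2M; lra.
- exact: dm_pos.
Qed.

Lemma NE_alternates j I : (1 <= j <= n)%N -> csel (psi j) I != 0 -> I = I_odd M \/ I = I_even M.
Proof.
move=> hj selI; apply: alternating_set => // s p sp.
have tM : (s.+1 < M)%N by rewrite sp.
have [sel_ge0 [_ /(_ I selI)/indepP ind]] := psi_valid hj.
have adj : path_adj s p by rewrite /path_adj sp eqxx.
have [sI|sI] := boolP (s \in I).
  by apply/negbTE/negP => pI; have := ind s p sI pI; rewrite adj.
apply/negPn/negP => pI; have := tight hj tM; rewrite /dm tM andbT hj => /eqP.
have -> : node_at s.+1 = p by apply: val_inj; rewrite /= modn_small.
rewrite node_at_id mulf_eq0 gt_eqF ?hq_pos //=; apply/negP; rewrite gt_eqF //.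
rewrite /skip_prob (bigD1 I) ?sI //=; apply: ltr_pwDl; last by apply: sumr_ge0.
by rewrite lt_neqAle eq_sym selI sel_ge0.
Qed.

Lemma NE_node_prob j s : (1 <= j <= n)%N ->
  node_prob (psi j) s = csel (psi j) (if odd s then I_even M else I_odd M).
Proof.
move=> hj; set I := if _ then _ else _.
have sI : s \in I by rewrite /I; case: ifP => os; rewrite inE os.
rewrite /node_prob (bigD1 I) //= big1 ?addr0 // => J /andP[sJ JI].
apply/eqP/negPn/negP => /(NE_alternates hj)[] eJ; move: sJ JI; rewrite eJ inE /I => os.
  by rewrite (negbTE os) eqxx.
by rewrite os eqxx.
Qed.

Lemma NE_sel_sum j : (1 <= j <= n)%N -> csel (psi j) (I_odd M) + csel (psi j) (I_even M) = 1.
Proof.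
move=> hj; have [_ [<- _]] := psi_valid hj.
rewrite [RHS](bigD1 (I_odd M)) //= (bigD1 (I_even M)) /=; last by rewrite eq_sym I_odd_neq_even.
rewrite big1 ?addr0 // => J /andP[Jo Je]; apply/eqP/negPn/negP => /(NE_alternates hj)[] eJ.
  by rewrite eJ eqxx in Jo.
by rewrite eJ eqxx in Je.
Qed.

Let odd_node_at (b : bool) : odd (node_at b) = b.
Proof. by rewrite node_atK ?oddb //; case: b => /=; nat_lia. Qed.

(** All nodes of one parity carry the same masses; [node_at] of a boolean, read as 0 or 1,
    represents each parity. *)
Let T_parity s k : (1 <= k)%N -> T s k = T (node_at (odd s)) k.
Proof.
move=> k1; apply: eq_big_nat => j hj; have hj' : (1 <= j <= n)%N by nat_lia.
by rewrite /node_mass !NE_node_prob // odd_node_at.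
Qed.

Let W_parity j s : (1 <= j <= n)%N -> W j s = W j (node_at (odd s)).
Proof.
move=> hj; apply: nodeval_ext; first by nat_lia.
by move=> k hk; apply: T_parity; nat_lia.
Qed.

Lemma NE_tail_sum k : (1 <= k)%N -> T (node_at 0) k + T (node_at 1) k = tail n q k.
Proof.
move=> k1; rewrite /tail -big_split /=; apply: eq_big_nat => j hj.
have hj' : (1 <= j <= n)%N by nat_lia.
rewrite /node_mass !NE_node_prob // (odd_node_at false) (odd_node_at true) /=.
by rewrite -mulrDr NE_sel_sum ?mulr1.
Qed.

Let K1 : R := #|I_odd M|%:R.
Let K2 : R := #|I_even M|%:R.
Let K2_gt0 : 0 < K2. Proof. by rewrite ltr0n card_even_gt0. Qed.
Let b_ge1 : 1 <= K1 / K2.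
Proof. by rewrite ler_pdivlMr // mul1r ler_nat card_even_le_odd. Qed.

Let sum_odd j : (1 <= j <= n)%N -> \sum_(s in I_odd M) W j s = K1 * W j (node_at 0).
Proof.
move=> hj; rewrite (eq_bigr (fun=> W j (node_at 0))).
  by rewrite sumr_const mulr_natl.
by move=> s; rewrite inE => /negbTE os; rewrite W_parity // os.
Qed.

Let sum_even j : (1 <= j <= n)%N -> \sum_(s in I_even M) W j s = K2 * W j (node_at 1).
Proof.
move=> hj; rewrite (eq_bigr (fun=> W j (node_at 1))).
  by rewrite sumr_const mulr_natl.
by move=> s; rewrite inE => os; rewrite W_parity // os.
Qed.

Let tail_step s j : (1 <= j <= n)%N -> T s j.+1 <= T s j.
Proof. by move=> hj; rewrite [leRHS]tailS // lerDr r_ge0. Qed.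

Lemma NE_balanced k : (1 <= k <= n.+1)%N ->
  balanced phi (K1 / K2) (T (node_at 0) k) (T (node_at 1) k).
Proof.
move=> hk; have /andP[A0 _] := hT (node_at 0) hk; have /andP[B0 _] := hT (node_at 1) hk.
have sum1 : T (node_at 0) k + T (node_at 1) k < 1.
  rewrite NE_tail_sum; last by nat_lia.
  have q0 j : (1 <= j <= n)%N -> 0 <= q j by move=> /hq_pos/ltW.
  by have /andP[] := tail_lt1 q0 hq_sum hk.
have [e|kn] := eqVneq k n.+1.
  by split => //; rewrite e !tail_end ?ltxx // (curve0 sc) mulr1.
have hk' : (1 <= k <= n)%N by nat_lia.
have bal := @two_phase_balance R n c v g f phi mk sc (T (node_at 0)) (T (node_at 1)) _ b_ge1
  (hT (node_at 0)) (hT (node_at 1)) (tail_end _ _) (tail_end _ _)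
  (tail_step (node_at 0)) (tail_step (node_at 1)).
have [||bal1 bal2] := bal _ _ k hk'; last by split.
- move=> j hj; rewrite mulrAC ltr_pdivrMr // [X in _ < X -> _]mulrC.
  rewrite -sum_odd // -sum_even // => lt; rewrite tailS //.
  suff -> : mass (node_at 0) j = 0 by rewrite add0r.
  rewrite /node_mass NE_node_prob // (odd_node_at false) /=.
  suff -> : csel (psi j) (I_odd M) = 0 by rewrite mulr0.
  apply/eqP/negPn/negP => /(NE_opt hj)/(_ (I_even_indep M)).
  by rewrite leNgt lt.
- move=> j hj; rewrite mulrAC ltr_pdivlMr // [X in X < _ -> _]mulrC.
  rewrite -sum_odd // -sum_even // => lt; rewrite tailS //.
  suff -> : mass (node_at 1) j = 0 by rewrite add0r.
  rewrite /node_mass NE_node_prob // (odd_node_at true) /=.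
  suff -> : csel (psi j) (I_even M) = 0 by rewrite mulr0.
  apply/eqP/negPn/negP => /(NE_opt hj)/(_ (I_odd_indep M)).
  by rewrite leNgt lt.
Qed.

End Equilibrium.

Lemma NE_unique (psi psi' : strategy R M) : sym_NE l m n q c v f psi -> sym_NE l m n q c v f psi' ->
  same_strategy n psi psi'.
Proof.
move=> ne ne'.
have K2_gt0 : 0 < #|I_even M|%:R :> R by rewrite ltr0n card_even_gt0.
have b_ge1 : 1 <= #|I_odd M|%:R / #|I_even M|%:R :> R.
  by rewrite ler_pdivlMr // mul1r ler_nat card_even_le_odd.
have eqT (b : bool) k : (1 <= k <= n.+1)%N ->
    tail n (node_mass q psi (node_at b)) k = tail n (node_mass q psi' (node_at b)) k.
  move=> hk; have := balanced_uniq sc b_ge1 (NE_balanced ne hk) (NE_balanced ne' hk).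
  rewrite !NE_tail_sum //; try nat_lia.
  by case=> // eA eB; case: b.
have eq_mass (b : bool) j : (1 <= j <= n)%N ->
    node_mass q psi (node_at b) j = node_mass q psi' (node_at b) j.
  move=> hj; have := eqT b j ltac:(nat_lia); rewrite [LHS]tailS // [RHS]tailS // eqT; last by nat_lia.
  exact: addIr.
have odd_at (b : bool) : odd (node_at b) = b by rewrite node_atK ?oddb //; case: b => /=; nat_lia.
have eq_prob j s : (1 <= j <= n)%N -> node_prob (psi j) s = node_prob (psi' j) s.
  move=> hj; have := eq_mass (odd s) j hj; rewrite /node_mass.
  move/(mulfI (lt0r_neq0 (hq_pos hj))); rewrite !(NE_node_prob ne, NE_node_prob ne') //.
  by rewrite odd_at.
have eq_massT s k : (1 <= k)%N -> tail n (node_mass q psi s) k = tail n (node_mass q psi' s) k.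
  by move=> k1; apply: eq_big_nat => j hj; rewrite /node_mass eq_prob //; nat_lia.
move=> j hj; split.
  apply/ffunP => I; have [->|Io] := eqVneq I (I_odd M).
    have := eq_prob j (node_at 0) hj.
    by rewrite (NE_node_prob ne) // (NE_node_prob ne') // (odd_at false).
  have [->|Ie] := eqVneq I (I_even M).
    have := eq_prob j (node_at 1) hj.
    by rewrite (NE_node_prob ne) // (NE_node_prob ne') // (odd_at true).
  have zero phi' : sym_NE l m n q c v f phi' -> csel (phi' j) I = 0.
    move=> ne0; apply/eqP/negPn/negP => /(NE_alternates ne0 hj) [] e.
      by rewrite e eqxx in Io.
    by rewrite e eqxx in Ie.
  by rewrite !zero.
move=> s ps; apply: prob_eq_below => x.
have rj : 0 < node_mass q psi s j by rewrite mulr_gt0 ?hq_pos.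
have rj' : 0 < node_mass q psi' s j by rewrite /node_mass -eq_prob // mulr_gt0 ?hq_pos.
have [lo hi mid] := NE_cdf ne x hj rj.
have [lo' hi' mid'] := NE_cdf ne' x hj rj'.
have eB k : brk c v g f phi (tail n (node_mass q psi' s)) k =
            brk c v g f phi (tail n (node_mass q psi s)) k.
  by apply: brk_ext => i /andP[i1 _]; rewrite eq_massT.
rewrite !eB in lo' hi' mid'.
have [xlo|xlo] := leP x (brk c v g f phi (tail n (node_mass q psi s)) j).
  by rewrite lo // lo'.
have [xhi|xhi] := leP (brk c v g f phi (tail n (node_mass q psi s)) j.-1) x.
  by rewrite hi // hi'.
have in_x : brk c v g f phi (tail n (node_mass q psi s)) j <= x <=
            brk c v g f phi (tail n (node_mass q psi s)) j.-1 by rewrite !ltW.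
have eW : nodeval c v g f phi (tail n (node_mass q psi s)) j =
          nodeval c v g f phi (tail n (node_mass q psi' s)) j.
  by apply: nodeval_ext => [|k /andP[k1 _]]; [case/andP: hj|exact: eq_massT].
have eq_mass' : node_mass q psi' s j = node_mass q psi s j by rewrite /node_mass eq_prob.
have := mid in_x; rewrite eW -(mid' in_x) eq_mass' -eq_massT //.
have fx : f j x - c != 0.
  have hTs : forall i, (1 <= i <= n.+1)%N -> 0 <= tail n (node_mass q psi s) i < 1.
    apply: tail_lt1; first exact: (node_mass_ge0 hq_pos ne.1).
    exact: (node_mass_tail1 hm1 hml hq_pos hq_sum ne.1).
  have := brk_gt' mk sc hTs hj; rewrite -(f_incr mk hj) in xlo => cB.
  by rewrite gt_eqF // subr_gt0 (lt_trans cB).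
have bnd P : 0 <= tail n (node_mass q psi s) j.+1 + node_mass q psi s j * below P x <= 1.
  have r0 : 0 <= node_mass q psi s j by exact: ltW.
  have hTs := tail_ge0 (node_mass_ge0 hq_pos ne.1 s) (ltn0Sn j).
  rewrite addr_ge0 ?(mulr_ge0 r0) ?below_ge0 //=.
  apply: le_trans (_ : tail n (node_mass q psi s) j <= _).
    by rewrite [leRHS]tailS // addrC lerD2r ler_piMr ?below_le1.
  apply: le_trans (tail_le1 (node_mass_ge0 hq_pos ne.1 s) _) _.
    by case/andP: hj => j1 jn; rewrite j1 /= ltnW.
  by apply: ltW; exact: (node_mass_tail1 hm1 hml hq_pos hq_sum ne.1).
by move/(mulfI fx)/(curve_inj sc (bnd _) (bnd _))/addrI/(mulfI (lt0r_neq0 rj)).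
Qed.

End Uniqueness.

(** * Laws given by quantiles *)

Section Quantile.
Variables (R : realType) (X : R -> R).
Hypothesis X_nd : forall a b, a <= b -> X a <= X b.

Definition unit_uniform : probability (measurableTypeR R) R := uniform_prob (@ltr01 R).

Lemma unit_uniformE (A : set (measurableTypeR R)) : measurable A ->
  unit_uniform A = lebesgue_measure (A `&` `[0, 1]).
Proof.
move=> mA; rewrite /unit_uniform /= /uniform_prob integral_uniform_pdf.
rewrite (eq_integral (fun=> 1%:E)); last first.
  by move=> x; rewrite inE /= in_itv /= => -[_ x01]; rewrite /uniform_pdf x01 subr0 invr1.
by rewrite integral_cst ?mul1e //; apply: measurableI.
Qed.

Let X' : measurableTypeR R -> R := X.

Let mX : measurable_fun [set: measurableTypeR R] X'.
Proof. by apply: nondecreasing_measurable => // a b; exact: X_nd. Qed.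

Definition quantile_law : probability R R :=
  distribution unit_uniform
    (HB.pack_for {mfun measurableTypeR R >-> R} X' (isMeasurableFun.Build _ _ _ _ X' mX)).

Lemma quantile_lawE A : quantile_law A = unit_uniform (X @^-1` A).
Proof. by []. Qed.

Lemma quantile_measurable (A : set R) : measurable A -> measurable (X @^-1` A : set (measurableTypeR R)).
Proof. by move=> mA; rewrite -[X in measurable X]setTI; exact: mX. Qed.

Lemma quantile_law_null (A : set R) : (forall p, ~ A (X p)) -> quantile_law A = 0%E.
Proof.
by move=> no; rewrite quantile_lawE (_ : X @^-1` A = set0) ?measure0 // -subset0 => p /no.
Qed.

Hypothesis X_inj : forall a b, 0 <= a -> a < b -> b <= 1 -> X a < X b.

(** Strict monotonicity leaves at most one point of the unit interval in each fibre of [X]. *)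
Lemma quantile_law_atomless x : quantile_law [set x] = 0%E.
Proof.
rewrite quantile_lawE unit_uniformE; last by apply: quantile_measurable; exact: measurable_set1.
have [[p [Xp /= p01]]|none] := pselect ((X @^-1` [set x] `&` `[0, 1]) !=set0); last first.
  rewrite (_ : X @^-1` [set x] `&` `[0, 1]%classic = set0) ?measure0 // -subset0 => p hp.
  by apply: none; exists p.
rewrite (_ : X @^-1` [set x] `&` `[0, 1]%classic = [set p]) ?lebesgue_measure_set1 //.
apply/seteqP; split => [p' [Xp' /= p'01]|p' ->] //=.
move: p01 p'01; rewrite !in_itv /= => /andP[p0 p1] /andP[p'0 p'1].
have e : X p = X p' by rewrite [LHS]Xp [RHS]Xp'.
have [lt|lt|//] := ltgtP p p'.
  by have := X_inj p0 lt p'1; rewrite e ltxx.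
by have := X_inj p'0 lt p1; rewrite e ltxx.
Qed.

Lemma quantile_law_below p : 0 <= p <= 1 -> below quantile_law (X p) = p.
Proof.
move=> /andP[p0 p1]; rewrite /below quantile_lawE unit_uniformE; last first.
  by apply: quantile_measurable; exact: measurable_ray.
rewrite (_ : _ `&` _ = `[0, p[%classic).
  rewrite lebesgue_measure_itv /= lte_fin; have [_|p0'] := ltP 0 p; first by rewrite -EFinB subr0.
  by apply/eqP; rewrite eq_le p0 p0'.
apply/seteqP; split => a /=; rewrite !in_itv /=.
  move=> [Xa /andP[a0 a1]]; rewrite a0 /= ltNge; apply/negP => pa.
  by move: Xa; rewrite ltNge X_nd.
move=> /andP[a0 ap]; rewrite a0 (le_trans (ltW ap) p1); split => //.
exact: X_inj.
Qed.

Lemma quantile_law_below0 x : x <= X 0 -> below quantile_law x = 0.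
Proof.
move=> xX; apply/eqP; rewrite eq_le below_ge0 andbT.
have <- : below quantile_law (X 0) = 0 by apply: quantile_law_below; rewrite lexx ler01.
exact: below_le.
Qed.

Lemma quantile_law_below1 x : X 1 <= x -> below quantile_law x = 1.
Proof.
move=> Xx; apply/eqP; rewrite eq_le below_le1 /=.
have <- : below quantile_law (X 1) = 1 by apply: quantile_law_below; rewrite lexx ler01.
exact: below_le.
Qed.

End Quantile.

(** * Penalty laws at one node with prescribed masses *)

Section NodeConstruction.
Variables (R : realType) (n : nat) (c v : R) (g f : nat -> R -> R) (phi : R -> R).
Hypotheses (n_gt0 : (1 <= n)%N) (mk : regular_market n c v g f) (sc : sale_curve phi).
Variables (r : nat -> R) (tie : R -> R -> R).
Hypothesis r_ge0 : forall j, (1 <= j <= n)%N -> 0 <= r j.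
Local Notation T := (tail n r).
Hypothesis r_sum : T 1%N < 1.
Hypothesis tie0 : forall p, tie p 0 = phi p.
Local Notation B := (brk c v g f phi T).
Local Notation W := (nodeval c v g f phi T).

Let hT j : (1 <= j <= n.+1)%N -> 0 <= T j < 1.
Proof. exact: tail_lt1. Qed.

(** Extends the quantile function from the unit interval to a nondecreasing function on the line, as
    [quantile_law] requires. *)
Let clamp (p : R) : R := Num.max 0 (Num.min 1 p).

Let clamp_in p : 0 <= clamp p <= 1.
Proof. by rewrite /clamp le_max lexx /= ge_max ler01 ge_min lexx. Qed.

Let clamp_le a b : a <= b -> clamp a <= clamp b.
Proof.
by move=> ab; rewrite /clamp ge_max !le_max lexx /= le_min !ge_min lexx ab !orbT.
Qed.

Let clampK p : 0 <= p <= 1 -> clamp p = p.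
Proof. by move=> /andP[p0 p1]; rewrite /clamp (min_idPr p1) (max_idPr p0). Qed.

(* The offer at quantile p is the penalty at which state j is indifferent when
   the mass of lower offers is T j.+1 + r j * p. *)
Definition quantile (j : nat) (p : R) : R :=
  if (1 <= j <= n)%N then g j (c + W j / phi (T j.+1 + r j * clamp p)) else 0.
Local Notation X := quantile.

Let arg_in j p : (1 <= j <= n)%N -> T j.+1 <= T j.+1 + r j * clamp p <= T j.
Proof.
move=> hj; have := clamp_in p => /andP[p0 p1].
by rewrite lerDl mulr_ge0 ?r_ge0 //= (@tailS R n r j hj) addrC lerD2r ler_piMr ?r_ge0.
Qed.

Let arg_bnd j p : (1 <= j <= n)%N -> 0 <= T j.+1 + r j * clamp p < 1.
Proof.
move=> hj; have /andP[lo hi] := arg_in p hj.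
have /andP[T0 _] := hT (j := j.+1) ltac:(nat_lia); have /andP[_ T1] := hT (j := j) ltac:(nat_lia).
by rewrite (le_trans T0 lo) (le_lt_trans hi T1).
Qed.

Let phi_arg j p : (1 <= j <= n)%N -> 0 < phi (T j.+1 + r j * clamp p).
Proof. by move=> hj; have /andP[] := arg_bnd p hj; exact: (curve_gt0 sc). Qed.

Let f_quantile j p : (1 <= j <= n)%N -> f j (X j p) - c = W j / phi (T j.+1 + r j * clamp p).
Proof. by move=> hj; rewrite /quantile hj (market_fg mk) //; ring. Qed.

Lemma quantile_nd j a b : a <= b -> X j a <= X j b.
Proof.
move=> ab; rewrite /quantile; case: ifP => // hj.
rewrite -(f_incr_le mk hj) !(market_fg mk) // lerD2l.
rewrite ler_pM2l ?(nodeval_gt0 mk sc hT hj) // lef_pV2 ?posrE ?phi_arg //.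
have /andP[lo _] := arg_bnd a hj; have /andP[_ /ltW hi] := arg_bnd b hj.
apply: (curve_anti sc) => //; rewrite lerD2l ler_wpM2l ?r_ge0 //; exact: clamp_le.
Qed.

Let quantile_inj j : (1 <= j <= n)%N -> 0 < r j ->
  forall a b, 0 <= a -> a < b -> b <= 1 -> X j a < X j b.
Proof.
move=> hj rj a b a0 ab b1; rewrite /quantile hj.
rewrite -(f_incr mk hj) !(market_fg mk) // ltrD2l.
rewrite ltr_pM2l ?(nodeval_gt0 mk sc hT hj) // ltf_pV2 ?posrE ?phi_arg //.
have /andP[lo _] := arg_bnd a hj; have /andP[_ /ltW hi] := arg_bnd b hj.
apply: (curve_decr sc) => //; rewrite ltrD2l ltr_pM2l //.
by rewrite !clampK ?a0 ?b1 ?(ltW (lt_le_trans ab b1)) ?(le_trans a0 (ltW ab)).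
Qed.

Let quantile0 j : (1 <= j <= n)%N -> X j 0 = B j.
Proof.
move=> hj; have := f_quantile 0 hj; rewrite clampK ?lexx ?ler01 // mulr0 addr0.
rewrite -(nodevalE mk sc hT hj) mulfK => [/addIr /(congr1 (g j))|].
  by rewrite !(market_gf mk).
by have := phi_arg 0 hj; rewrite clampK ?lexx ?ler01 // mulr0 addr0 => /gt_eqF ->.
Qed.

Let quantile1 j : (1 <= j <= n)%N -> X j 1 = B j.-1.
Proof.
move=> hj; have := f_quantile 1 hj; rewrite clampK ?lexx ?ler01 // mulr1.
have -> : T j.+1 + r j = T j by rewrite [RHS]tailS // addrC.
rewrite /nodeval mulfK => [/addIr /(congr1 (g j))|].
  by rewrite !(market_gf mk).
by have /andP[h0 h1] := hT (j := j) ltac:(nat_lia); rewrite gt_eqF // (curve_gt0 sc).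
Qed.

Definition law (j : nat) : probability R R := quantile_law (@quantile_nd j).
Local Notation F := (lt_mass n r law).
Local Notation E := (at_mass n r law).

Let no_atom x : E x = 0.
Proof.
rewrite /at_mass big_nat_cond big1 // => j hj; have hj' : (1 <= j <= n)%N by nat_lia.
have := r_ge0 hj'; rewrite le_eqVlt => /predU1P[<-|rj]; first by rewrite mul0r.
by rewrite /law quantile_law_atomless ?mulr0 //; exact: quantile_inj.
Qed.

Let B_le i j : (i <= j <= n)%N -> B j <= B i.
Proof.
move=> /andP[]; elim: j => [|j IH] ij jn; first by have -> : i = 0%N by nat_lia.
have [->//|ne] := eqVneq i j.+1.
apply: (@le_trans _ _ (B j)); last by apply: IH; nat_lia.
have hj : (1 <= j.+1 <= n)%N by nat_lia.
by apply: (brk_anti mk sc hT hj); rewrite [leRHS]tailS // lerDr r_ge0.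
Qed.

Let F_at k x y : (1 <= k <= n)%N -> B k <= x <= B k.-1 ->
  (0 < r k -> y = T k.+1 + r k * below (law k) x) -> (r k = 0 -> y = T k.+1) -> F x = y.
Proof.
move=> hk /andP[Bx xB] y_pos y_0.
rewrite /lt_mass (@big_cat_nat _ _ _ k) /=; try nat_lia.
rewrite big_nat_cond big1 ?add0r; last first.
  move=> j hj; have hj' : (1 <= j <= n)%N by nat_lia.
  have := r_ge0 hj'; rewrite le_eqVlt => /predU1P[<-|rj]; first by rewrite mul0r.
  rewrite /law (quantile_law_below0 _ (quantile_inj hj' rj)) ?mulr0 // quantile0 //.
  by apply: le_trans xB _; apply: B_le; nat_lia.
rewrite big_ltn; last by nat_lia.
have -> : \sum_(k.+1 <= j < n.+1) r j * below (law j) x = T k.+1.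
  apply: eq_big_nat => j hj; have hj' : (1 <= j <= n)%N by nat_lia.
  have := r_ge0 hj'; rewrite le_eqVlt => /predU1P[<-|rj]; first by rewrite mul0r.
  rewrite /law (quantile_law_below1 _ (quantile_inj hj' rj)) ?mulr1 // quantile1 //.
  by apply: le_trans Bx; apply: B_le; nat_lia.
have := r_ge0 hk; rewrite le_eqVlt => /predU1P[r0|rk].
  by rewrite -r0 mul0r add0r y_0.
by rewrite y_pos // addrC.
Qed.

(** If state [k] carries no mass, its interval is a single point. Otherwise the intermediate value
    theorem gives the mass [y] that makes state [k] indifferent at [x], and [x] is the quantile of
    the corresponding level. *)
Let value_on k x : (1 <= k <= n)%N -> B k <= x <= B k.-1 -> (f k x - c) * phi (F x) = W k.
Proof.
move=> hk /[dup] Bx /andP[Bx1 Bx2].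
have := r_ge0 hk; rewrite le_eqVlt => /predU1P[r0|rk].
  have -> : F x = T k.+1 by apply: (F_at hk Bx) => //; rewrite -r0 ltxx.
  have Tk : T k = T k.+1 by rewrite [LHS]tailS // -r0 add0r.
  suff -> : x = B k by exact: (nodevalE mk sc hT hk).
  apply/eqP; rewrite eq_le Bx1 andbT (le_trans Bx2) //.
  rewrite -(f_incr_le mk hk) -(lerD2r (- c)) (f_brk phi mk T hk) -Tk mulfK //.
  by have /andP[h0 h1] := hT (j := k) ltac:(nat_lia); rewrite gt_eqF // (curve_gt0 sc).
have cB : c < f k (B k) by exact: (brk_gt' mk sc hT hk).
have fx : 0 < f k x - c by rewrite subr_gt0 (lt_le_trans cB) // (f_incr_le mk hk).
have [T0 T0'] : 0 <= T k.+1 /\ T k.+1 < 1 by have /andP[] := hT (j := k.+1) ltac:(nat_lia).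
have [T1 T1'] : 0 <= T k /\ T k < 1 by have /andP[] := hT (j := k) ltac:(nat_lia).
have TT : T k.+1 <= T k by rewrite [leRHS]tailS // lerDr ltW.
have [y] : exists2 y, y \in `[T k.+1, T k]%R & phi y = W k / (f k x - c).
  apply: IVT => //; first by apply: continuous_subspaceT; exact: (curve_cont sc).
  have lo : phi (T k) <= W k / (f k x - c).
    by rewrite ler_pdivlMr // mulrC /nodeval ler_pM2r ?(curve_gt0 sc) // lerD2r (f_incr_le mk hk).
  have hi : W k / (f k x - c) <= phi (T k.+1).
    rewrite ler_pdivrMr // mulrC -(nodevalE mk sc hT hk) ler_pM2r ?(curve_gt0 sc) //.
    by rewrite lerD2r (f_incr_le mk hk).
  by rewrite ge_min lo orbT /= le_max hi.
rewrite in_itv /= => /andP[y0 y1] phi_y.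
pose p := (y - T k.+1) / r k.
have p01 : 0 <= p <= 1.
  rewrite /p divr_ge0 ?subr_ge0 ?(ltW rk) //= ler_pdivrMr // mul1r lerBlDr.
  by have e := @tailS R n r k hk; rewrite -e.
have yE : T k.+1 + r k * p = y by rewrite /p mulrC divfK ?gt_eqF //; ring.
have xE : x = X k p.
  rewrite /quantile hk clampK // yE phi_y invf_div mulrC divfK ?gt_eqF ?(nodeval_gt0 mk sc hT hk) //.
  by rewrite addrC subrK (market_gf mk).
have -> : F x = y.
  apply: (F_at hk Bx) => [_|r0]; last by rewrite r0 ltxx in rk.
  by rewrite -yE; congr (_ + _ * _); rewrite xE /law quantile_law_below //; exact: quantile_inj.
by rewrite phi_y mulrC divfK // gt_eqF.
Qed.

Let FE_pos x : 0 < phi (F x).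
Proof.
have F0 : 0 <= F x.
  rewrite /lt_mass big_nat_cond; apply: sumr_ge0 => j hj.
  by rewrite mulr_ge0 ?below_ge0 // r_ge0 //; nat_lia.
apply: (curve_gt0 sc) => //; apply: le_lt_trans r_sum; apply: ler_sum_nat => j hj.
by rewrite ler_piMr ?below_le1 // r_ge0 //; nat_lia.
Qed.

Let at_brk k : (1 <= k <= n)%N -> B k <= B k <= B k.-1 /\ B k <= B k.-1 <= B k.-1.
Proof.
move=> hk; have h : B k <= B k.-1 by apply: B_le; nat_lia.
by rewrite !lexx h.
Qed.

(** State [k] is indifferent on its own interval, so by single crossing the higher state [i] does at
    least as well at its lower endpoint [B k], which belongs to the next interval; iteration leads
    to the interval of [i]. *)
Let value_up i k x : (1 <= i <= n)%N -> (1 <= k <= i)%N -> B k <= x <= B k.-1 ->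
  (f i x - c) * phi (F x) <= W i.
Proof.
move=> hi; move e : (i - k)%N => d; elim: d k x e => [|d IH] k x e hk Bx.
  have ki : k = i by nat_lia.
  by rewrite ki in Bx *; rewrite value_on.
have hk' : (1 <= k <= n)%N by nat_lia.
have Bk : B k.+1 <= B k <= B k.+1.-1 by apply: (at_brk (k := k.+1) _).2; nat_lia.
apply: le_trans (IH k.+1 (B k) _ _ Bk); try nat_lia.
have /andP[Bx1 Bx2] := Bx.
have cB : c < f k (B k) by exact: (brk_gt' mk sc hT hk').
have fx : c < f k x by rewrite (lt_le_trans cB) // (f_incr_le mk hk').
have e1 := value_on hk' Bx; have e2 := value_on hk' (at_brk hk').1.
rewrite -(@ler_pM2l _ ((f k x - c) * (f k (B k) - c))) ?mulr_gt0 ?subr_gt0 //.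
rewrite [X in X <= _](_ : _ = ((f k (B k) - c) * (f i x - c)) * ((f k x - c) * phi (F x))); last by ring.
rewrite [X in _ <= X](_ : _ = ((f k x - c) * (f i (B k) - c)) * ((f k (B k) - c) * phi (F (B k)))); last by ring.
rewrite e1 e2 ler_pM2r ?(nodeval_gt0 mk sc hT hk') //.
by apply: (margin_ratio_le mk) => //; nat_lia.
Qed.

(** The mirror image of [value_up], moving to upper endpoints. Penalties with a nonpositive margin
    are dismissed beforehand, because single crossing needs a positive margin at the lower
    penalty. *)
Let value_down i k x : (1 <= i <= n)%N -> (i <= k <= n)%N -> B k <= x <= B k.-1 ->
  (f i x - c) * phi (F x) <= W i.
Proof.
move=> hi; elim: k x => [|k IH] x hk Bx; first by nat_lia.
have [ik|ne] := eqVneq i k.+1; first by rewrite ik in Bx *; rewrite value_on // -ik.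
have hk' : (1 <= k.+1 <= n)%N by nat_lia.
have [fi|fi] := leP (f i x) c.
  apply: le_trans (ltW (nodeval_gt0 mk sc hT hi)).
  by rewrite mulr_le0_ge0 ?subr_le0 ?(ltW (FE_pos x)).
have Bk : B k <= B k <= B k.-1 by apply: (at_brk (k := k) _).1; nat_lia.
apply: le_trans (IH (B k) _ Bk); last by nat_lia.
have /andP[Bx1 Bx2] := Bx; rewrite /= in Bx2.
have fx : c < f k.+1 x by apply: lt_trans fi _; apply: (f_state mk); nat_lia.
have fB : c < f k.+1 (B k) by exact: (brk_gt mk sc hT hk').
have e1 := value_on hk' Bx; have e2 := value_on hk' (at_brk hk').2.
rewrite /= in e2.
rewrite -(@ler_pM2l _ ((f k.+1 x - c) * (f k.+1 (B k) - c))) ?mulr_gt0 ?subr_gt0 //.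
rewrite [X in X <= _](_ : _ = ((f i x - c) * (f k.+1 (B k) - c)) * ((f k.+1 x - c) * phi (F x))); last by ring.
rewrite [X in _ <= X](_ : _ = ((f i (B k) - c) * (f k.+1 x - c)) * ((f k.+1 (B k) - c) * phi (F (B k)))); last by ring.
rewrite e1 e2 ler_pM2r ?(nodeval_gt0 mk sc hT hk') //.
by apply: (margin_ratio_le mk) => //; nat_lia.
Qed.

(** The intervals cover all penalties from [B n] to [v]. Below [B n] nobody undercuts, nor at [B n]
    itself, so [B n] is sold as surely and earns more. *)
Let value_le i x : (1 <= i <= n)%N -> x <= v -> (f i x - c) * phi (F x) <= W i.
Proof.
move=> hi xv.
have on_interval k y : (1 <= k <= n)%N -> B k <= y <= B k.-1 -> (f i y - c) * phi (F y) <= W i.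
  move=> hk By; have [ki|ik] := leqP k i; first by apply: value_up By => //; nat_lia.
  by apply: value_down By => //; nat_lia.
have [Bn|Bn] := leP (B n) x.
  suff [k hk Bx] : exists2 k, (1 <= k <= n)%N & B k <= x <= B k.-1 by exact: on_interval Bx.
  have ex : exists k, B k <= x by exists n.
  (* Index 0 is minimal only for [x = v], the top of the first interval. *)
  case: (ex_minnP ex) => -[|k] Bk min_k; last first.
    exists k.+1; first by have := min_k n Bn; nat_lia.
    by rewrite Bk /= leNgt; apply/negP => /ltW/min_k; rewrite ltnn.
  have B10 : B 1%N <= B 0%N by apply: B_le; nat_lia.
  by exists 1%N; [nat_lia|rewrite (le_trans B10 Bk) xv].
have hn : (1 <= n <= n)%N by nat_lia.
have Fn : F (B n) = 0.
  rewrite (F_at hn (at_brk hn).1 (y := 0)) // ?tail_end ?add0r // => rn.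
  by rewrite /law (quantile_law_below0 _ (quantile_inj hn rn)) ?mulr0 ?quantile0.
apply: le_trans (on_interval n (B n) hn (at_brk hn).1).
have Fx : F x = 0.
  apply/eqP; rewrite eq_le; apply/andP; split; last first.
    rewrite /lt_mass big_nat_cond; apply: sumr_ge0 => j hj.
    by rewrite mulr_ge0 ?below_ge0 // r_ge0 //; nat_lia.
  rewrite -Fn; apply: ler_sum_nat => j hj; have hj' : (1 <= j <= n)%N by nat_lia.
  by rewrite ler_wpM2l ?r_ge0 //; exact/below_le/ltW.
by rewrite Fx Fn ler_wpM2r // ?(curve0 sc) // lerD2r (f_incr_le mk hi) ltW.
Qed.

Let B_le_v j : (j <= n)%N -> B j <= v.
Proof. by move=> hj; apply: (@B_le 0%N j); nat_lia. Qed.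

Lemma law_offer_le i x : (1 <= i <= n)%N -> offer_value n c v f r law tie i x <= W i.
Proof.
move=> hi; rewrite /offer_value; case: ifP => xv; last exact/ltW/(nodeval_gt0 mk sc hT hi).
by rewrite no_atom tie0; exact: value_le.
Qed.

Lemma law_offer_null i : (1 <= i <= n)%N ->
  law i [set x | offer_value n c v f r law tie i x < W i] = 0%E.
Proof.
move=> hi; apply: quantile_law_null => p /=; apply/negP; rewrite -leNgt.
have Bx : B i <= X i p <= B i.-1.
  rewrite -quantile0 // -quantile1 //.
  have e : X i p = X i (clamp p) by rewrite /quantile hi (clampK (clamp_in p)).
  by have /andP[p0 p1] := clamp_in p; rewrite e !quantile_nd.
have xv : X i p <= v.
  by have /andP[_ xB] := Bx; apply: le_trans xB _; apply: B_le_v; nat_lia.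
by rewrite /offer_value xv no_atom tie0 value_on.
Qed.

End NodeConstruction.

(** * Existence *)

Section Existence.
Variables (R : realType) (M l m n : nat) (q : nat -> R) (c v : R) (g f : nat -> R -> R).
Hypotheses (hM : (2 <= M)%N) (hm1 : (1 <= m)%N) (hml : (m < l)%N) (hn : (1 <= n)%N).
Hypothesis hq_pos : forall j, (1 <= j <= n)%N -> 0 < q j.
Hypothesis hq_sum : \sum_(1 <= j < n.+1) q j < 1.
Hypothesis mk : regular_market n c v g f.
Local Notation phi := (@sale R l.-1 m).
Local Notation K1 := (#|I_odd M|%:R : R).
Local Notation K2 := (#|I_even M|%:R : R).
Local Notation b := (K1 / K2).

Let sc : sale_curve phi := game_sale_curve hm1 hml hq_sum.

Let K2_gt0 : 0 < K2. Proof. by rewrite ltr0n card_even_gt0. Qed.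
Let b_ge1 : 1 <= b.
Proof. by rewrite ler_pdivlMr // mul1r ler_nat card_even_le_odd. Qed.
Let b_gt0 : 0 < b. Proof. exact: lt_le_trans b_ge1. Qed.

Variable A : nat -> R.
Hypothesis A_balanced : forall k, (1 <= k <= n.+1)%N -> balanced phi b (A k) (tail n q k - A k).

Let A_end : A n.+1 = 0.
Proof.
have /A_balanced[A0 B0 _ _ _] : (1 <= n.+1 <= n.+1)%N by rewrite leqnn.
by apply/eqP; rewrite eq_le A0; move: B0; rewrite tail_end sub0r oppr_ge0 => ->.
Qed.

(** The probability of the odd set in state [j]: the chosen solutions [A] are to be its tails, so
    its mass in one state is a difference. *)
Let t j : R := (A j - A j.+1) / q j.

Let t01 j : (1 <= j <= n)%N -> 0 <= t j <= 1.
Proof.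
move=> hj; have qj := hq_pos hj.
have [|||Ale Ble] := @balanced_le _ _ _ sc b_ge1 (A j) (tail n q j - A j) (A j.+1) (tail n q j.+1 - A j.+1).
- by apply: A_balanced; nat_lia.
- by apply: A_balanced; nat_lia.
- by have e := @tailS R n q j hj; lra.
have e := @tailS R n q j hj.
by rewrite /t divr_ge0 ?subr_ge0 ?(ltW qj) //= ler_pdivrMr // mul1r; lra.
Qed.

(* Indices start at 0, so parity [true] stands for the even-numbered nodes. *)
Let mass (p : bool) j : R := q j * (if p then 1 - t j else t j).
Local Notation T p := (tail n (mass p)).

Let mass_ge0 p j : (1 <= j <= n)%N -> 0 <= mass p j.
Proof.
move=> hj; have /andP[t0 t1] := t01 hj; apply: mulr_ge0; first exact/ltW/hq_pos.
by case: p; rewrite ?subr_ge0.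
Qed.

Let tail_odd k : (1 <= k <= n.+1)%N -> T false k = A k.
Proof.
move=> hk; move e : (n.+1 - k)%N => d; elim: d k hk e => [|d IH] k hk e.
  have -> : k = n.+1 by nat_lia.
  by rewrite tail_end A_end.
have hk' : (1 <= k <= n)%N by nat_lia.
rewrite tailS // IH; [|nat_lia|nat_lia].
by rewrite /mass /t mulrC divfK ?subrK // gt_eqF ?hq_pos.
Qed.

Let tail_sum k : T false k + T true k = tail n q k.
Proof. by rewrite /tail -big_split /=; apply: eq_bigr => j _; rewrite /mass; ring. Qed.

Let tail_balanced k : (1 <= k <= n.+1)%N -> balanced phi b (T false k) (T true k).
Proof.
move=> hk; have := A_balanced hk; rewrite -tail_odd // -tail_sum.
by rewrite (_ : _ + _ - _ = T true k) //; ring.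
Qed.

Let mass_sum p : T p 1%N < 1.
Proof.
have [|A0 B0 AB _ _] := @tail_balanced 1%N; first by nat_lia.
by case: p; lra.
Qed.

Let hT p j : (1 <= j <= n.+1)%N -> 0 <= T p j < 1.
Proof. by apply: tail_lt1; [exact: mass_ge0|exact: mass_sum]. Qed.

Local Notation W p := (nodeval c v g f phi (T p)).

Let value_le j : (1 <= j <= n)%N -> W true j <= b * W false j.
Proof.
have fv : 0 <= f 1%N v - c by rewrite subr_ge0 ltW // (market_v mk).
elim: j => // -[_ _|j IH hj].
  have [|_ _ _ le _] := @tail_balanced 1%N; first by nat_lia.
  by rewrite /nodeval mulrCA ler_wpM2l.
apply: (nodeval_step mk sc b_gt0 (hT false) (hT true)); [nat_lia|nat_lia|by apply: IH; nat_lia|].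
by have [|] := @tail_balanced j.+2; first by nat_lia.
Qed.

(** Balance is an equality while the even set has a positive tail, and tails are nonincreasing, so
    it is an equality in all earlier states too. The comparison then runs with the two nodes
    interchanged and [b] inverted. *)
Let value_ge j : (1 <= j <= n)%N -> 0 < T true j -> W false j <= b^-1 * W true j.
Proof.
have fv : 0 <= f 1%N v - c by rewrite subr_ge0 ltW // (market_v mk).
have bal k : (1 <= k <= n)%N -> 0 < T true k -> phi (T false k) <= b^-1 * phi (T true k).
  move=> hk Tk; have [|_ _ _ _ ->//] := @tail_balanced k; first by nat_lia.
  by rewrite mulKf // gt_eqF.
elim: j => // -[_ hj Tj|j IH hj Tj].
  by rewrite /nodeval mulrCA ler_wpM2l // bal.
have hj' : (1 <= j.+1 <= n)%N by nat_lia.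
have Tj' : 0 < T true j.+1.
  by apply: lt_le_trans Tj _; rewrite [leRHS]tailS // lerDr mass_ge0.
have b'_gt0 : 0 < b^-1 by rewrite invr_gt0.
apply: (nodeval_step mk sc b'_gt0 (hT true) (hT false)); [nat_lia|nat_lia|exact: IH|exact: bal].
Qed.

Definition alternating_strategy : strategy R M := fun j =>
  Defs.Choice
    [ffun I => if I == I_odd M then t j else if I == I_even M then 1 - t j else 0]
    (fun s => law hn mk sc (mass_ge0 (odd s)) (mass_sum (odd s)) j).
Local Notation psi := alternating_strategy.

Let sel_sum j (P : pred {set 'I_M}) :
  \sum_(I | P I) csel (psi j) I =
  (if P (I_odd M) then t j else 0) + (if P (I_even M) then 1 - t j else 0).
Proof.
rewrite big_mkcond (bigD1 (I_odd M)) //= (bigD1 (I_even M)) /=; last first.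
  by rewrite eq_sym (I_odd_neq_even (ltnW hM)).
rewrite big1 ?addr0 => [|I /andP[/negbTE Io /negbTE Ie]]; last by rewrite ffunE Io Ie if_same.
by rewrite !ffunE !eqxx [I_even M == I_odd M]eq_sym (negbTE (I_odd_neq_even (ltnW hM))).
Qed.

Let sel_alternates j I : csel (psi j) I != 0 ->
  (I = I_odd M) \/ (I = I_even M /\ 1 - t j != 0).
Proof.
rewrite ffunE; have [->|_] := eqVneq I (I_odd M); first by left.
by have [->|_] := eqVneq I (I_even M); [right|rewrite eqxx].
Qed.

Let psi_valid : valid_strategy n psi.
Proof.
move=> j hj; have /andP[t0 t1] := t01 hj; split; [|split] => [I||I].
- by rewrite ffunE; case: ifP => // _; case: ifP; rewrite ?subr_ge0.
- by rewrite sel_sum addrC subrK.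
- by case/sel_alternates => [->|[-> _]]; [exact: I_odd_indep|exact: I_even_indep].
Qed.

Let psi_mass s : node_mass q psi s = mass (odd s).
Proof.
apply/funext => j; rewrite /node_mass /node_prob sel_sum !inE /mass.
by case: (odd s); rewrite ?add0r ?addr0.
Qed.

Let sum_odd j : \sum_(s in I_odd M) W (odd s) j = K1 * W false j.
Proof.
rewrite (eq_bigr (fun=> W false j)) ?sumr_const ?mulr_natl // => s.
by rewrite inE => /negbTE ->.
Qed.

Let sum_even j : \sum_(s in I_even M) W (odd s) j = K2 * W true j.
Proof.
rewrite (eq_bigr (fun=> W true j)) ?sumr_const ?mulr_natl // => s.
by rewrite inE => ->.
Qed.

Lemma alternating_NE : sym_NE l m n q c v f psi.
Proof.
have W_gt0 p j : (1 <= j <= n)%N -> 0 < W p j by exact: (nodeval_gt0 mk sc (hT p)).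
apply: (NE_sufficient mk psi_valid (V := fun j s => W (odd s) j)) => [j s hj|j s x hj|j I J hj selI indJ|j s hj _].
- exact/ltW/W_gt0.
- by rewrite node_payoffE psi_mass; exact: law_offer_le.
- have odd_best : \sum_(s in J) W (odd s) j <= K1 * W false j.
    rewrite (eq_bigr (fun s : 'I_M => if odd s then W true j else W false j)); last first.
      by move=> s _; case: (odd s).
    apply: indep_weight_le => //; try exact/ltW/W_gt0.
    have := value_le hj; rewrite mulrAC ler_pdivlMr // mulrC.
    by [].
  apply: le_trans odd_best _.
  case: (sel_alternates selI) => [->|[-> t1]]; first by rewrite sum_odd.
  rewrite sum_even -ler_pdivlMl; last first.
    by have := b_gt0; rewrite pmulr_lgt0 // invr_gt0.
  (* A state that selects the even set gives it a positive tail, so the two sets have equal totals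
     there. *)
  have T_gt0 : 0 < T true j.
    rewrite tailS //; apply: ltr_pwDl.
      have /andP[_ t1'] := t01 hj.
      by rewrite mulr_gt0 ?hq_pos // lt_neqAle eq_sym t1 subr_ge0.
    by apply: tail_ge0 => // i; exact: mass_ge0.
  by rewrite mulrA [_^-1 * _]mulrC -invf_div; exact: value_ge.
- have null := @law_offer_null _ _ _ _ _ _ _ hn mk sc _ (@tie_sale R l.-1 m)
    (mass_ge0 (odd s)) (mass_sum (odd s)) (fun=> erefl) _ hj.
  apply: etrans null; congr (law _ _ _ _ _ _ _).
  by apply/seteqP; split=> x /=; rewrite node_payoffE psi_mass.
Qed.

End Existence.

Theorem theorem6 (R : realType) (M l m n : nat) (q : nat -> R) (c v : R)
  (g f : nat -> R -> R)
  (hM : (2 <= M)%N) (hm1 : (1 <= m)%N) (hml : (m < l)%N) (hn : (1 <= n)%N)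
  (hq_pos : forall j, (1 <= j <= n)%N -> 0 < q j)
  (hq_sum : \sum_(1 <= j < n.+1) q j < 1)
  (hg_cont : forall j, (1 <= j <= n)%N -> continuous (g j))
  (hg_incr : forall j, (1 <= j <= n)%N -> forall p p', p < p' -> g j p < g j p')
  (hfg : forall j, (1 <= j <= n)%N -> forall p, f j (g j p) = p)
  (hgf : forall j, (1 <= j <= n)%N -> forall x, g j (f j x) = x)
  (hg_order : forall i j, (1 <= j)%N -> (j < i)%N -> (i <= n)%N ->
     forall p, g i p < g j p)
  (hratio : forall i j, (1 <= i)%N -> (i < j)%N -> (j <= n)%N ->
     forall x y, g i c < y -> y < x ->
       (f i y - c) / (f j y - c) < (f i x - c) / (f j x - c))
  (hf1v : c < f 1%N v) :
  exists psi : strategy R M,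
    sym_NE l m n q c v f psi /\
    (forall psi' : strategy R M, sym_NE l m n q c v f psi' -> same_strategy n psi psi') /\
    (forall j, (1 <= j <= n)%N -> forall I : {set 'I_M},
       csel (psi j) I != 0 -> I = I_odd M \/ I = I_even M).
Proof.
have mk := RegularMarket hg_incr hfg hgf hg_order hratio hf1v.
have sc := game_sale_curve hm1 hml hq_sum.
have b_ge1 : 1 <= #|I_odd M|%:R / #|I_even M|%:R :> R.
  by rewrite ler_pdivlMr ?mul1r ?ler_nat ?card_even_le_odd // ltr0n card_even_gt0.
have /choice[A A_bal] k : exists a, (1 <= k <= n.+1)%N ->
    balanced (@sale R l.-1 m) (#|I_odd M|%:R / #|I_even M|%:R) a (tail n q k - a).
  have [hk|_] := boolP (1 <= k <= n.+1)%N; last by exists 0.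
  have q_ge0 j : (1 <= j <= n)%N -> 0 <= q j by move=> /hq_pos/ltW.
  by have [a ha] := balanced_exists sc b_ge1 (tail_lt1 q_ge0 hq_sum hk); exists a.
have ne := alternating_NE hM hm1 hml hn hq_pos hq_sum mk A_bal.
exists (alternating_strategy hM hm1 hml hn hq_pos hq_sum mk A_bal); split=> //.
split=> [psi' ne'|j hj I]; first exact: (NE_unique hM hm1 hml hn hq_pos hq_sum mk).
exact: (NE_alternates hM hm1 hml hn hq_pos hq_sum mk ne).
Qed.
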